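(* Assume \[ \lim_{n\to\infty}\|a_n^{-1}\|=0,\qquad \lim_{n\to\infty}\|a_n^{-1}b_n\|=0 \] and (a) $\displaystyle\sum_{n=1}^\infty \frac{\|[a_{n+1}a_{n+1}^*-a_n^*a_n]^-\|}{\|a_n\|^2}<\infty$, (b) $\displaystyle\sum_{n=1}^\infty \frac{\|a_nb_{n+1}-b_na_n\|}{\|a_n\|^2}<\infty$, (c) $\displaystyle\sum_{n=0}^\infty \frac{1}{\|a_n\|^2}=\infty$. Then the operator $A$ is self-adjoint. Moreover, $\sigma(A)=\mathbb{R}$ and $\sigma_{\mathrm p}(A)=\emptyset$ provided that \[ \lim_{n\to\infty}\left\|\frac{a_n}{\|a_n\|}-C\right\|=0 \] for some invertible bounded operator $C$ on $\mathcal H$.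
   Context: Let $\mathcal H$ be a complex Hilbert space, and let $(a_n:n\ge 0)$, $(b_n:n\ge 0)$ be sequences of bounded linear operators on $\mathcal H$ such that every $a_n$ has a bounded inverse and every $b_n$ is self-adjoint. $\|\cdot\|$ is the operator norm and $X^*$ is the adjoint of $X$. The formal matrix $\mathcal A$ acts on any sequence $u=(u_n:n\ge0)$ of elements of $\mathcal H$ by $(\mathcal A u)_0=b_0u_0+a_0u_1$ and $(\mathcal A u)_n=a_{n-1}^*u_{n-1}+b_nu_n+a_nu_{n+1}$ for $n\ge1$. The operator $A$ (block Jacobi matrix) is the closure in $\ell^2(\mathbb N;\mathcal H)$ (with $\mathbb N=\{0,1,2,\dots\}$) of the restriction of $\mathcal A$ to the finitely supported sequences. $\sigma(A)$ is the spectrum of $A$ and $\sigma_{\mathrm p}(A)$ is the set of its eigenvalues. For a self-adjoint bounded operator $X$, $X^-$ is defined through the spectral theorem from the function $x^-=\max(0,-x)$. *)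

(* Defs.v *)
From HB Require Import structures.
From mathcomp Require Import all_boot all_order all_algebra sesquilinear.
From mathcomp Require Import complex.
From mathcomp Require Import ring lra.
From mathcomp Require Import all_classical all_reals ereal topology normedtype sequences.
Set Implicit Arguments.
Unset Strict Implicit.
Unset Printing Implicit Defensive.
Import Order.TTheory GRing.Theory Num.Theory numFieldNormedType.Exports.
Local Open Scope classical_set_scope.
Local Open Scope ring_scope.
Local Open Scope complex_scope.

(* Complex Hilbert spaces; [inner] is linear on the left. *)
HB.mixin Record isHilbert (R : realType) H & CompleteNormedModule R[i] H := {
  inner : {dot H for @Num.conj R[i]} ;
  normr_inner : forall x : H, `|x| ^+ 2 = inner x x }.

#[short(type="hilbertType")]
HB.structure Definition Hilbert (R : realType) :=
  { H of isHilbert R H & CompleteNormedModule R[i] H }.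

(* [`|x|] has values in R[i]; [hnorm] is the same norm with values in R. *)
Definition hnorm (R : realType) (H : normedModType R[i]) (x : H) : R :=
  complex.Re `|x|.

Section DotTheory.
Variables (C : numClosedFieldType) (U : lmodType C).
Variable form : {dot U for @Num.conj C}.

Lemma dot_CauchySchwarz u v :
  `|form u v| <= sqrtC (form u u) * sqrtC (form v v).
Proof.
have [->|v0] := eqVneq v 0.
  by rewrite !linear0r normr0 sqrtC0 mulr0.
have fv : 0 < form v v by apply: neq0_dnorm_gt0.
rewrite -(sqrCK (normr_ge0 _)) -sqrtCM ?nnegrE ?dnorm_ge0//.
rewrite ler_sqrtC ?nnegrE ?mulr_ge0 ?exprn_ge0 ?dnorm_ge0//.
pose a := form u v / form v v; pose u1 := u - a *: v.
have ou : form u1 v = 0.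
  by rewrite linearBl/= linearZl_LR divfK ?subrr// gt_eqF.
have -> : u = u1 + a *: v by rewrite subrK.
rewrite linearDl /= ou add0r linearZl_LR/= normrM (ger0_norm (dnorm_ge0 _ _)).
rewrite exprMn hnormDd/=; last by rewrite linearZr_LR/= ou mulr0.
by rewrite dnormZ mulrDl (expr2 (form v v)) mulrA lerDr mulr_ge0 ?dnorm_ge0.
Qed.

Lemma dot_triangle u v :
  sqrtC (form (u + v) (u + v)) <= sqrtC (form u u) + sqrtC (form v v).
Proof.
rewrite -(@ler_pXn2r _ 2)// ?nnegrE ?addr_ge0 ?sqrtC_ge0 ?dnorm_ge0//.
rewrite sqrrD !sqrtCK dnormD [X in _ <= X]addrAC lerD2l.
have -> : form u v + (form u v)^* = 'Re (form u v) *+ 2.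
  by rewrite ReE -mulr_natr divfK ?pnatr_eq0.
rewrite lerMn2r/=.
apply: le_trans (dot_CauchySchwarz u v).
by have := leif_Re_Creal (form u v); case.
Qed.

End DotTheory.

Section HnormTheory.
Variables (R : realType) (H : normedModType R[i]).
Implicit Types x y : H.

Lemma hnormE x : (hnorm x)%:C = `|x|.
Proof. by rewrite /hnorm RRe_real// normr_real. Qed.

Lemma hnorm_ge0 x : 0 <= hnorm x.
Proof. by rewrite -ler0c hnormE. Qed.

Lemma hnorm0 : hnorm (0 : H) = 0.
Proof. by rewrite /hnorm normr0. Qed.

Lemma hnormN x : hnorm (- x) = hnorm x.
Proof. by rewrite /hnorm normrN. Qed.

Lemma ler_hnormD x y : hnorm (x + y) <= hnorm x + hnorm y.
Proof. by rewrite -lecR rmorphD/= !hnormE ler_normD. Qed.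

Lemma hnormZ (a : R[i]) x : hnorm (a *: x) = complex.Re `|a| * hnorm x.
Proof.
rewrite /hnorm normrZ; have /complex_realP[k ->] := normr_real a.
have /complex_realP[l ->] := normr_real x.
by rewrite /= mulr0 subr0.
Qed.

Lemma hdistC x y : hnorm (x - y) = hnorm (y - x).
Proof. by rewrite -hnormN opprB. Qed.

Lemma ler_hdist x y : `|hnorm x - hnorm y| <= hnorm (x - y).
Proof.
rewrite ler_norml lerBrDl !lerBlDr; apply/andP; split.
  by rewrite hdistC addrC -{1}(subrK x y) ler_hnormD.
by rewrite -{1}(subrK y x) ler_hnormD.
Qed.

End HnormTheory.

Section ComplexSeries.
Variable R : realType.
Implicit Types z : nat -> R[i].

Lemma conjCE (x : R[i]) : Num.conj x = conjc x.
Proof.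
have [->|x0] := eqVneq x 0; first by rewrite rmorph0 conjc0.
by apply: (mulfI x0); rewrite -normCK sqr_normc.
Qed.

Definition csummable z :=
  cvgn (series (fun n => complex.Re (z n))) /\
  cvgn (series (fun n => complex.Im (z n))).

Definition csum z : R[i] :=
  limn (series (fun n => complex.Re (z n))) +i*
  limn (series (fun n => complex.Im (z n))).

Lemma csumD z1 z2 : csummable z1 -> csummable z2 ->
  csum (fun n => z1 n + z2 n) = csum z1 + csum z2.
Proof.
move=> [r1 i1] [r2 i2]; rewrite /csum.
apply/eqP; rewrite eq_complex; apply/andP; split => /=; apply/eqP.
  by rewrite -lim_seriesD//; congr (limn (series _)); apply/funext => n;
    rewrite fctE; case: (z1 n) (z2 n) => [? ?] [? ?].
by rewrite -lim_seriesD//; congr (limn (series _)); apply/funext => n;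
  rewrite fctE; case: (z1 n) (z2 n) => [? ?] [? ?].
Qed.

Lemma csumZ a z : csummable z -> csum (fun n => a * z n) = a * csum z.
Proof.
move=> [r i]; rewrite /csum.
have er : (fun n => complex.Re (a * z n)) =
    complex.Re a *: (fun n => complex.Re (z n)) +
    (- complex.Im a) *: (fun n => complex.Im (z n)).
  by apply/funext => n; rewrite !fctE; case: a (z n) => [? ?] [? ?]; rewrite scaleNr.
have ei : (fun n => complex.Im (a * z n)) =
    complex.Re a *: (fun n => complex.Im (z n)) +
    complex.Im a *: (fun n => complex.Re (z n)).
  by apply/funext => n; rewrite !fctE; case: {er} a (z n) => [? ?] [? ?].
have rk k := is_cvg_seriesZ (k := k) r; have ik k := is_cvg_seriesZ (k := k) i.
rewrite er ei !lim_seriesD// !lim_seriesZ//.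
by case: a {er ei} => a1 a2 /=; rewrite scaleNr.
Qed.

Lemma csum_conj z : csummable z ->
  csum (fun n => Num.conj (z n)) = Num.conj (csum z).
Proof.
move=> [r i]; rewrite /csum /=.
have -> : (fun n => complex.Re (Num.conj (z n))) = fun n => complex.Re (z n).
  by apply/funext => n; rewrite conjCE; case: (z n).
have -> : (fun n => complex.Im (Num.conj (z n))) =
    - (fun n => complex.Im (z n)).
  by apply/funext => n; rewrite conjCE fctE; case: (z n).
by rewrite lim_seriesN// conjCE.
Qed.

End ComplexSeries.

Section L2.
Variables (R : realType) (H : hilbertType R).
Implicit Types u v : nat -> H.

Definition square_summable u := cvgn (series (fun n => hnorm (u n) ^+ 2)).

Definition square_summable_pred : {pred nat -> H} :=
  [pred u | `[< square_summable u >]].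

Lemma le_square_summable (w : nat -> R) u :
  (forall n, hnorm (u n) ^+ 2 <= w n) -> cvgn (series w) -> square_summable u.
Proof.
move=> uw; apply: series_le_cvg => // n; rewrite ?sqr_ge0//.
exact: le_trans (sqr_ge0 _) (uw n).
Qed.

Lemma square_summable_submod : submod_closed square_summable_pred.
Proof.
split=> [|a u v /asboolP us /asboolP vs]; apply/asboolP.
  rewrite /square_summable (_ : (fun n => _) = 0 *: (0 : nat -> R)).
    by rewrite scale0r /series/=; under eq_fun do rewrite big1//; exact: is_cvg_cst.
  by apply/funext => n; rewrite scale0r /= hnorm0 expr0n.
apply: (@le_square_summable
  ((2 * complex.Re `|a| ^+ 2) *: (fun n => hnorm (u n) ^+ 2) +
   2 *: (fun n => hnorm (v n) ^+ 2))); last first.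
  by apply: is_cvg_seriesD; exact: is_cvg_seriesZ.
move=> n; rewrite !fctE.
have := ler_hnormD (a *: u n) (v n); rewrite hnormZ.
have := sqr_ge0 (complex.Re `|a| * hnorm (u n) - hnorm (v n)).
set p := _ * hnorm (u n); set q := hnorm (v n); set s := hnorm _ => h1 h2.
apply: (@le_trans _ _ ((p + q) ^+ 2)).
  by rewrite ler_sqr ?nnegrE ?(le_trans (hnorm_ge0 _) h2)// hnorm_ge0.
rewrite -subr_ge0; apply: le_trans h1 _; rewrite le_eqVlt; apply/orP; left.
rewrite /p /q /GRing.scale/=; apply/eqP; ring.
Qed.

HB.instance Definition _ :=
  GRing.isSubmodClosed.Build _ _ square_summable_pred square_summable_submod.

Definition l2 := {u : nat -> H | u \in square_summable_pred}.

HB.instance Definition _ := SubChoice.on l2.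
HB.instance Definition _ := [SubChoice_isSubLmodule of l2 by <:].

Lemma l2P (u : l2) : square_summable (val u).
Proof. by have /asboolP := valP u. Qed.

Lemma inner_normE (x : H) : inner x x = ((hnorm x) ^+ 2)%:C.
Proof. by rewrite rmorphXn/= hnormE normr_inner. Qed.

Lemma norm_inner_le (x y : H) : `|inner x y| <= (hnorm x * hnorm y)%:C.
Proof.
apply: le_trans (dot_CauchySchwarz (@inner R H) x y) _.
by rewrite -!normr_inner !sqrCK// rmorphM/= !hnormE.
Qed.

Lemma csummable_inner (u v : l2) :
  csummable (fun n => inner (val u n) (val v n)).
Proof.
have suv : cvgn (series (fun n => hnorm (val u n) ^+ 2 + hnorm (val v n) ^+ 2)).
  by apply: is_cvg_seriesD; exact: l2P.
have le n : `|inner (val u n) (val v n)| <=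
    (hnorm (val u n) ^+ 2 + hnorm (val v n) ^+ 2)%:C.
  apply: le_trans (norm_inner_le _ _) _; rewrite lecR.
  move: (hnorm _) (hnorm _) (hnorm_ge0 (val u n)) (hnorm_ge0 (val v n)).
  by move=> p q p0 q0; nra.
split; apply: normed_cvg; apply: series_le_cvg suv => n //=;
  rewrite ?addr_ge0 ?sqr_ge0// -lecR; apply: le_trans (le n).
  exact: normc_ge_Re.
by rewrite normc_def lecR -sqrtr_sqr ler_wsqrtr// lerDr sqr_ge0.
Qed.

Definition l2_inner (u v : l2) : R[i] :=
  csum (fun n => inner (val u n) (val v n)).

Lemma csummableZ a (u v : l2) :
  csummable (fun n => a * inner (val u n) (val v n)).
Proof.
rewrite (_ : (fun n => _) = fun n => inner (val (a *: u) n) (val v n)).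
  exact: csummable_inner.
by apply/funext => n; rewrite linearZl_LR.
Qed.

Lemma l2_inner_bilinear :
  bilinear_for *%R (@Num.conj R[i] \; *%R) l2_inner.
Proof.
split=> [v a u1 u2|u a v1 v2] /=; rewrite /l2_inner.
  rewrite -csumZ; last exact: csummable_inner.
  rewrite -csumD; [|exact: csummableZ|exact: csummable_inner].
  by congr csum; apply/funext => n; rewrite /= linearDl/= linearZl_LR.
rewrite -csumZ; last exact: csummable_inner.
rewrite -csumD; [|exact: csummableZ|exact: csummable_inner].
by congr csum; apply/funext => n; rewrite /= linearDr/= linearZr_LR.
Qed.

HB.instance Definition _ := bilinear_isBilinear.Build R[i] l2 l2 R[i]
  *%R (@Num.conj R[i] \; *%R) l2_inner l2_inner_bilinear.

Lemma l2_inner_hermitian (u v : l2) :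
  l2_inner u v = (-1) ^+ false * Num.conj (l2_inner v u).
Proof.
rewrite expr0 mul1r /l2_inner -csum_conj; last exact: csummable_inner.
by congr csum; apply/funext => n; rewrite hermC expr0 mul1r.
Qed.

HB.instance Definition _ := isHermitianSesquilinear.Build R[i] l2 false
  (@Num.conj R[i]) l2_inner l2_inner_hermitian.

Lemma l2_inner_normE (u : l2) :
  l2_inner u u = (limn (series (fun n => hnorm (val u n) ^+ 2)))%:C.
Proof.
rewrite /l2_inner /csum.
rewrite (_ : (fun n => complex.Re _) = fun n => hnorm (val u n) ^+ 2); last first.
  by apply/funext => n; rewrite inner_normE.
rewrite (_ : (fun n => complex.Im _) = fun=> 0); last first.
  by apply/funext => n; rewrite inner_normE.
congr (_ +i* _); rewrite /series/=; under eq_fun do rewrite big1//.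
exact: lim_cst.
Qed.

Lemma le_l2_series (u : l2) n :
  \sum_(0 <= k < n) hnorm (val u k) ^+ 2 <= complex.Re (l2_inner u u).
Proof.
rewrite l2_inner_normE/=.
have su : cvgn (series (fun n => hnorm (val u n) ^+ 2)) by exact: l2P.
have nd : nondecreasing_seq (series (fun n => hnorm (val u n) ^+ 2)).
  by apply: nondecreasing_series => k _ _; exact: sqr_ge0.
exact: (nondecreasing_cvgn_le nd su n).
Qed.

Lemma l2_coord_le (u : l2) n :
  hnorm (val u n) ^+ 2 <= complex.Re (l2_inner u u).
Proof.
apply: le_trans (le_l2_series u n.+1).
by rewrite big_nat_recr//= lerDr sumr_ge0// => k _; exact: sqr_ge0.
Qed.

Lemma l2_inner_gt0 (u : l2) : u != 0 -> 0 < l2_inner u u.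
Proof.
move=> u0; have [n un0] : exists n, val u n != 0.
  apply/not_existsP => uall0; move/eqP: u0; apply; apply/val_inj/funext => n.
  by apply/eqP/negPn/negP; exact: uall0.
rewrite l2_inner_normE (ltcR 0).
have := l2_coord_le u n; rewrite l2_inner_normE/=; apply: lt_le_trans.
by rewrite exprn_gt0// -(ltcR 0) hnormE normr_gt0.
Qed.

HB.instance Definition _ := isDotProduct.Build R[i] l2 l2_inner l2_inner_gt0.

Definition l2_norm (u : l2) : R[i] := sqrtC (l2_inner u u).

Lemma ler_l2_normD (u v : l2) : l2_norm (u + v) <= l2_norm u + l2_norm v.
Proof. exact: dot_triangle. Qed.

Lemma l2_normZ (a : R[i]) (u : l2) : l2_norm (a *: u) = `|a| * l2_norm u.
Proof. by rewrite /l2_norm dnormZ sqrtCM ?nnegrE ?dnorm_ge0// sqrCK. Qed.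

Lemma l2_norm0_eq0 (u : l2) : l2_norm u = 0 -> u = 0.
Proof. by move/eqP; rewrite sqrtC_eq0 dnorm_eq0 => /eqP. Qed.

HB.instance Definition _ := Lmodule_isNormed.Build R[i] l2
  ler_l2_normD l2_normZ l2_norm0_eq0.

Lemma normr_l2_inner (u : l2) : `|u| ^+ 2 = l2_inner u u.
Proof. exact: sqrtCK. Qed.

Lemma hnorm_l2E (u : l2) :
  hnorm u ^+ 2 = limn (series (fun n => hnorm (val u n) ^+ 2)).
Proof.
by apply: (@complexI R); rewrite rmorphXn/= hnormE normr_l2_inner l2_inner_normE.
Qed.

Lemma hnorm_coord_le (u : l2) n : hnorm (val u n) <= hnorm u.
Proof.
rewrite -(@ler_pXn2r _ 2)// ?nnegrE ?hnorm_ge0//.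
by have := l2_coord_le u n; rewrite l2_inner_normE/= hnorm_l2E.
Qed.

Lemma hnorm_l2_series_le (u : l2) n :
  \sum_(0 <= k < n) hnorm (val u k) ^+ 2 <= hnorm u ^+ 2.
Proof. by have := le_l2_series u n; rewrite l2_inner_normE/= hnorm_l2E. Qed.

Lemma l2_bounded_series (w : nat -> H) (M : R) : 0 <= M ->
  (forall n, \sum_(0 <= k < n) hnorm (w k) ^+ 2 <= M ^+ 2) ->
  exists u : l2, val u = w /\ hnorm u <= M.
Proof.
move=> M0 wM.
have nd : nondecreasing_seq (series (fun n => hnorm (w n) ^+ 2)).
  by apply: nondecreasing_series => k _ _; exact: sqr_ge0.
have sw : cvgn (series (fun n => hnorm (w n) ^+ 2)).
  by apply: nondecreasing_is_cvgn => //; exists (M ^+ 2) => _ [n _ <-]; exact: wM.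
have wP : w \in square_summable_pred by apply/asboolP.
exists (exist _ w wP); split => //.
rewrite -(@ler_pXn2r _ 2)// ?nnegrE ?hnorm_ge0// hnorm_l2E/=.
by apply: limr_le => //; apply: nearW => n; exact: wM.
Qed.

Lemma l2_complete (F : set_system l2) : ProperFilter F -> cauchy F -> cvg F.
Proof.
move=> FF /cauchy_ballP Fc.
have Fball (e : R) : 0 < e -> 
    \forall u \near F, \forall v \near F, hnorm (u - v) < e.
  move=> e0; have e0C : 0 < e%:C by rewrite (ltcR 0).
  apply: nearP_dep; have := Fc _ e0C; apply: filterS => -[u v] /=.
  by rewrite -ball_normE /ball_/= -hnormE ltcR.
have realC (e : R[i]) : 0 < e -> exists2 r : R, 0 < r & e = r%:C.
  move=> e0; have /complex_realP[r er] : e \is Num.real by exact: gtr0_real.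
  by exists r => //; rewrite -(ltcR 0) -er.
have /choice[w Fw] n : exists x : H, forall e : R, 0 < e ->
    \forall u \near F, hnorm (val u n - x) < e.
  have gc : cauchy ((fun u : l2 => val u n) @ F).
    apply: cauchy_exP => _ /realC[e e0 ->].
    have /filter_ex[u Fu] := Fball _ e0.
    exists (val u n); apply: filterS Fu => v uv; rewrite -ball_normE /ball_/=.
    by rewrite -hnormE ltcR; apply: le_lt_trans uv; exact: (hnorm_coord_le (u - v)).
  have /cvg_ex[x gx] : cvg ((fun u : l2 => val u n) @ F) by exact: cauchy_cvg.
  exists x => e e0; have e0C : 0 < e%:C by rewrite (ltcR 0).
  have /cvgrPdist_lt/(_ _ e0C) := gx; apply: filterS => u.
  by rewrite distrC -hnormE ltcR.
have key (e : R) : 0 < e -> \forall u \near F, exists d : l2,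
    val d = val u - w /\ hnorm d <= e.
  move=> e0; have := Fball _ e0; apply: filterS => u Fu.
  apply: l2_bounded_series => [|n]; first exact: ltW.
  have cS : \sum_(0 <= k < n) hnorm (val u k - val v k) ^+ 2 @[v --> F] -->
      \sum_(0 <= k < n) hnorm (val u k - w k) ^+ 2.
    apply: (cvg_big (op := +%R)) => [|k _]; first exact: add_continuous.
    suff ck : hnorm (val u k - val v k) @[v --> F] --> hnorm (val u k - w k).
      exact: (cvgM ck ck).
    apply/cvgrPdist_lt => d d0; have := Fw k _ d0; apply: filterS => v.
    apply: le_lt_trans; apply: le_trans (ler_hdist _ _) _.
    by rewrite opprD addrACA subrr add0r opprK addrC.
  apply: (ler_cvg_to cS (cvg_cst (e ^+ 2))); apply: filterS Fu => v uv.
  apply: le_trans (hnorm_l2_series_le (u - v) n) _.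
  by rewrite ler_sqr ?nnegrE ?hnorm_ge0 ?(ltW e0)// ltW.
have /filter_ex[u0 [d0 [d0E _]]] := key _ ltr01.
have uE : val (u0 - d0) = w by rewrite /= d0E opprB addrC subrK.
apply/cvg_ex; exists (u0 - d0); apply/cvgrPdist_lt => _ /realC[e e0 ->].
have e20 : 0 < e / 2 by rewrite divr_gt0.
have := key _ e20; apply: filterS => v [d [dE de]].
have -> : u0 - d0 - v = - d.
  by apply/val_inj; rewrite /= dE -uE opprB.
rewrite normrN -hnormE ltcR (le_lt_trans de)//.
by rewrite ltr_pdivrMr// ltr_pMr// ltr1n.
Qed.

HB.instance Definition _ := Uniform_isComplete.Build l2 l2_complete.
HB.instance Definition _ := isHilbert.Build R l2 normr_l2_inner.

End L2.

Section BoundedOperators.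
Variables (R : realType) (H : hilbertType R).
Implicit Types X Y : H -> H.

Definition bounded_operator X :=
  linear X /\ exists M : R, forall x, hnorm (X x) <= M * hnorm x.

Definition is_bounded_inverse X Y :=
  [/\ bounded_operator Y, cancel X Y & cancel Y X].

Definition opnorm X : R := sup [set hnorm (X x) | x in [set x | hnorm x <= 1]].

(* [adjoint X y] is the vector representing x |-> <X x, y>; the default value 0
   of [xget] plays no role when X is bounded, by Riesz' theorem. *)
Definition adjoint X : H -> H :=
  fun y => xget 0 [set z | forall x, inner (X x) y = inner x z].

End BoundedOperators.

(* Unbounded operators of a Hilbert space K are represented by their graphs in
   K * K. *)
Section UnboundedOperators.
Variables (R : realType) (K : hilbertType R).
Implicit Types T : set (K * K).

Definition graph (X : K -> K) : set (K * K) := [set p | p.2 = X p.1].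

Definition domain T : set K := [set u | exists v, T (u, v)].

Definition adjoint_graph T : set (K * K) :=
  [set p | forall u v, T (u, v) -> inner v p.1 = inner u p.2].

Definition selfadjoint T := dense (domain T) /\ T = adjoint_graph T.

(* B is the everywhere defined bounded inverse of T - z. *)
Definition is_resolvent T (z : R[i]) (B : K -> K) :=
  bounded_operator B /\ forall u v, T (u, v) <-> u = B (v - z *: u).

Definition spectrum T : set R[i] := [set z | ~ exists B, is_resolvent T z B].

Definition point_spectrum T : set R[i] :=
  [set z | exists2 u, u != 0 & T (u, z *: u)].

End UnboundedOperators.

Section FunctionalCalculus.
Variables (R : realType) (H : hilbertType R).
Implicit Types X Y : H -> H.

Definition poly_operator (p : {poly R}) X : H -> H :=
  fun x => \sum_(i < size p) (p`_i)%:C *: iter i X x.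

(* Y = f(X) in the continuous functional calculus of a bounded self-adjoint
   operator X: it is the norm limit of p_k(X) for real polynomials p_k that
   converge to f uniformly on the spectrum of X. *)
Definition is_functional_calculus (f : R -> R) X Y :=
  bounded_operator Y /\ exists p : nat -> {poly R},
    {uniform [set t : R | spectrum (graph X) t%:C],
      (fun k => horner (p k)) @ \oo --> f} /\
    opnorm (poly_operator (p k) X \- Y) @[k --> \oo] --> (0 : R).

Definition functional_calculus (f : R -> R) X : H -> H :=
  xget (fun=> 0) [set Y | is_functional_calculus f X Y].

Definition negative_part X : H -> H :=
  functional_calculus (fun t => Num.max 0 (- t)) X.

End FunctionalCalculus.

Section BlockJacobi.
Variables (R : realType) (H : hilbertType R).
Variables a b : nat -> H -> H.

Definition formal_jacobi (u : nat -> H) (n : nat) : H :=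
  if n is m.+1 then adjoint (a m) (u m) + b n (u n) + a n (u n.+1)
  else b 0 (u 0) + a 0 (u 1).

Definition minimal_jacobi : set (l2 H * l2 H) :=
  [set p | finite_set [set n | val p.1 n != 0] /\
           val p.2 = formal_jacobi (val p.1)].

Definition block_jacobi : set (l2 H * l2 H) := closure minimal_jacobi.

End BlockJacobi.

(* Main.v *)
Require Import Defs.
From mathcomp Require Import all_boot all_order all_algebra sesquilinear.
From mathcomp Require Import complex.
From mathcomp Require Import ring lra.
From mathcomp Require Import all_classical all_reals ereal topology normedtype sequences.
Set Implicit Arguments.
Unset Strict Implicit.
Unset Printing Implicit Defensive.
Import Order.TTheory GRing.Theory Num.Theory numFieldNormedType.Exports.
Local Open Scope classical_set_scope.
Local Open Scope ring_scope.
Local Open Scope complex_scope.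

(** Write A for the formal matrix and call maximal the graph of the pairs (u, v)
    of square-summable sequences with v = A u.

    Self-adjointness only needs Carleman's condition: the sum of 1 / ||a_n||
    diverges.  It follows from (c), because ||a_n|| >= 1 / ||a_n^-1|| >= 1 for
    large n ([carleman_condition]).  Green's identity, tested on finitely supported
    sequences, says that the maximal graph is the adjoint of the minimal one
    ([adjoint_minimal_jacobi]); since a graph and its closure have the same adjoint,
    it remains to approximate each pair of the maximal graph by finitely supported
    ones ([maximal_sub_closure]).  Multiply u by a cutoff that equals 1 up to N and
    then decreases by 1 / ||a_k|| at step k: Carleman's condition brings it down to
    0, and its step times ||a_k|| is at most 1, so that the commutator of A with
    the cutoff is bounded by the tail of u alone.

    The spectral part reduces to one fact ([no_square_summable_solution]): for real
    l, a square-summable u with (A u)_n = l u_n for all n >= 1 is zero.  Row 0 is not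
    imposed, and this serves both purposes.  An eigenvector of A has a real
    eigenvalue and satisfies these equations, so there is none.  And if a real l had
    a resolvent, its value at a nonzero sequence carried by the index 0 would be such
    a u, hence zero, which is absurd.  Nonreal points are in the resolvent set of
    every self-adjoint graph ([selfadjoint_spectrum_real]).

    For that fact, follow the energy
      E_n = |a_n^* u_n|^2 + |a_n u_(n+1)|^2 - Re <(l - b_n) u_n, a_n u_(n+1)>.
    The limit of a_n / ||a_n|| is invertible and a_n^-1 (l - b_n) tends to 0, so E_n
    is comparable with ||a_n||^2 (|u_n|^2 + |u_(n+1)|^2) ([energy_bounds]).  In
    E_(n+1) - E_n the terms containing l cancel because l is real, and what remains
    ([energyS]) is bounded below through (a) and (b):
    E_(n+1) >= (1 - t_n) E_n with summable t_n.  Hence E_n cannot decay to 0 once it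
    is positive, and |u_n|^2 + |u_(n+1)|^2 >= const / ||a_n||^2, which (c) forbids for
    a square-summable u.  So E_N = 0 for some N, two consecutive terms of u vanish,
    and the recurrence propagates this in both directions.

    Hypothesis (a) enters only through the inequality
    <X x, x> >= - ||X^-|| |x|^2 ([negative_part_form_ge]).  As X^- is a norm limit of
    polynomials in X, this is a matter of comparing the values of a real polynomial q
    on the spectrum of X with the form of q(X) ([poly_operator_ge]), and of showing
    that X^- exists ([functional_calculus_exists]).  Let m be the infimum of the form
    of q(X) over unit vectors.  Then q(X) - m is not bounded below; factoring q - m
    over the complex numbers, some X - t is not bounded below either; so t is a
    real point of the spectrum and m = q(t). *)

(** * Inner products and norms *)

Section Dot.
Variables (R : realType) (H : hilbertType R).
Implicit Types x y z : H.

(** All estimates are made in the underlying real Hilbert space; complex identities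
    are recovered by [inner_ext]. *)
Definition rdot x y : R := complex.Re (inner x y).

Lemma rdotC x y : rdot x y = rdot y x.
Proof. by rewrite /rdot hermC expr0 mul1r /= conjCE; case: (inner y x). Qed.

Lemma rdotDl x y z : rdot (x + y) z = rdot x z + rdot y z.
Proof. by rewrite /rdot linearDl /=; case: (inner x z) (inner y z) => [? ?] []. Qed.

Lemma rdotNl x z : rdot (- x) z = - rdot x z.
Proof. by rewrite /rdot linearNl /=; case: (inner x z). Qed.

Lemma rdotBl x y z : rdot (x - y) z = rdot x z - rdot y z.
Proof. by rewrite rdotDl rdotNl. Qed.

Lemma rdotZl (k : R) x y : rdot (k%:C *: x) y = k * rdot x y.
Proof.
by rewrite /rdot linearZl_LR /=; case: (inner x y) => p q /=; rewrite mul0r subr0.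
Qed.

Lemma rdotDr x y z : rdot z (x + y) = rdot z x + rdot z y.
Proof. by rewrite rdotC rdotDl !(rdotC z). Qed.

Lemma rdotNr x z : rdot z (- x) = - rdot z x.
Proof. by rewrite rdotC rdotNl (rdotC z). Qed.

Lemma rdotBr x y z : rdot z (x - y) = rdot z x - rdot z y.
Proof. by rewrite rdotC rdotBl !(rdotC z). Qed.

Lemma rdotZr (k : R) x y : rdot x (k%:C *: y) = k * rdot x y.
Proof. by rewrite rdotC rdotZl rdotC. Qed.

Lemma rdot0l y : rdot 0 y = 0. Proof. by rewrite /rdot linear0l. Qed.
Lemma rdot0r y : rdot y 0 = 0. Proof. by rewrite rdotC rdot0l. Qed.

Definition rdotE := (rdotDl, rdotDr, rdotNl, rdotNr, rdotZl, rdotZr).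

Lemma rdotxx x : rdot x x = hnorm x ^+ 2.
Proof. by rewrite /rdot inner_normE. Qed.

Lemma Im_inner x y : complex.Im (inner x y) = rdot x ('i *: y).
Proof.
rewrite /rdot linearZr_LR /=; case: (inner x y) => p q /=.
by rewrite mul0r sub0r mulN1r opprK.
Qed.

Lemma inner_ext x y x' y' : (forall c : R[i], rdot x (c *: y) = rdot x' (c *: y')) ->
  inner x y = inner x' y'.
Proof.
move=> e; apply/eqP; rewrite eq_complex !Im_inner e eqxx andbT.
by have := e 1; rewrite !scale1r => /eqP.
Qed.

Lemma hnormDsq x y : hnorm (x + y) ^+ 2 = hnorm x ^+ 2 + hnorm y ^+ 2 + 2 * rdot x y.
Proof. rewrite -!rdotxx !rdotE (rdotC y x); ring. Qed.

Lemma hnormBsq x y : hnorm (x - y) ^+ 2 = hnorm x ^+ 2 + hnorm y ^+ 2 - 2 * rdot x y.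
Proof. rewrite hnormDsq Defs.hnormN !rdotE; ring. Qed.

Lemma rdot_le x y : `|rdot x y| <= hnorm x * hnorm y.
Proof. by rewrite -lecR; apply: le_trans (norm_inner_le x y); exact: normc_ge_Re. Qed.

Lemma ler_rdot x y : rdot x y <= hnorm x * hnorm y.
Proof. exact: le_trans (ler_norm _) (rdot_le x y). Qed.

Lemma hnorm_eq0 x : (hnorm x == 0) = (x == 0).
Proof. by rewrite -(inj_eq (@complexI R)) hnormE normr_eq0. Qed.

Lemma hnorm_gt0 x : (0 < hnorm x) = (x != 0).
Proof. by rewrite lt_neqAle hnorm_ge0 andbT eq_sym hnorm_eq0. Qed.

Lemma hnormZr (k : R) x : hnorm (k%:C *: x) = `|k| * hnorm x.
Proof. by rewrite hnormZ normc_def /= expr0n /= addr0 sqrtr_sqr. Qed.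

Lemma ler_hnormB x y : hnorm (x - y) <= hnorm x + hnorm y.
Proof. by rewrite -(Defs.hnormN y) ler_hnormD. Qed.

Lemma hnorm_triangle x y z : hnorm (x - z) <= hnorm (x - y) + hnorm (y - z).
Proof. by rewrite -{1}(subrK y x) -addrA ler_hnormD. Qed.

Lemma hnorm_small0 x (K : R) : (forall e, 0 < e -> hnorm x <= K * e) -> x = 0.
Proof.
move=> h; apply/eqP; rewrite -hnorm_eq0; apply/eqP/le_anti; rewrite hnorm_ge0 andbT.
apply/ler_addgt0Pl => e e0; rewrite addr0; have K0 : 0 < `|K| + 1 by rewrite ltr_wpDl.
apply: le_trans (h (e / (`|K| + 1)) _) _; first by rewrite divr_gt0.
rewrite mulrA ler_pdivrMr// mulrC ler_pM2l//.
by apply: le_trans (ler_norm _) _; rewrite lerDl.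
Qed.

Lemma hilbert_complete (y : nat -> H) :
  (forall e : R, 0 < e -> exists N, forall m n, (N <= m)%N -> (N <= n)%N ->
    hnorm (y m - y n) < e) ->
  exists l, forall e : R, 0 < e -> exists N, forall n, (N <= n)%N -> hnorm (l - y n) < e.
Proof.
move=> yc.
have realC (e : R[i]) : 0 < e -> exists2 r : R, 0 < r & e = r%:C.
  move=> e0; have /complex_realP[r er] : e \is Num.real by exact: gtr0_real.
  by exists r => //; rewrite -(ltcR 0) -er.
have gc : cauchy (y @ \oo).
  apply: cauchy_exP => _ /realC[e e0 ->].
  have [N hN] := yc _ e0; exists (y N); exists N => // n /= Nn.
  by rewrite -ball_normE /ball_/= -hnormE ltcR; exact: hN.
have /cvg_ex[l yl] : cvg (y @ \oo) by exact: cauchy_cvg.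
exists l => e e0; have e0C : 0 < e%:C by rewrite (ltcR 0).
have /cvgrPdist_lt/(_ _ e0C)[N _ hN] := yl.
by exists N => n Nn; have := hN n Nn; rewrite /= -hnormE ltcR.
Qed.

End Dot.

(** * Orthogonal projection and Riesz representation *)

Section Projection.
Variables (R : realType) (H : hilbertType R).
Implicit Types x y z : H.

Definition subspace (M : set H) :=
  M 0 /\ forall (k : R[i]) x y, M x -> M y -> M (k *: x + y).

(** Closedness, stated with real radii although the norm of H takes complex values. *)
Definition adherent_closed (M : set H) := forall x,
  (forall e : R, 0 < e -> exists2 m, M m & hnorm (x - m) < e) -> M x.

Lemma inv_succ_lt (e : R) : 0 < e -> exists N, forall n, (N <= n)%N -> n.+1%:R^-1 < e.
Proof.
move=> e0; have [N _ hN] : \forall n \near \oo, n.+1%:R^-1 < e.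
  have /cvgrPdist_lt/(_ _ e0) := @cvg_harmonic R; apply: filterS => n.
  by rewrite sub0r normrN ger0_norm ?invr_ge0.
by exists N.
Qed.

Lemma quadratic_vanish (r s : R) : 0 <= s -> (forall k, 2 * k * r <= k ^+ 2 * s) -> r = 0.
Proof.
move=> s0 h; have s1 : 0 < s + 1 by rewrite ltr_wpDl.
have := h (r / (s + 1)); rewrite -subr_le0.
have -> : 2 * (r / (s + 1)) * r - (r / (s + 1)) ^+ 2 * s =
    (r / (s + 1)) ^+ 2 * (s + 2) by field; rewrite gt_eqF.
rewrite pmulr_lle0; last by rewrite ltr_wpDl.
move=> h1; have : (r / (s + 1)) ^+ 2 == 0 by rewrite eq_le h1 sqr_ge0.
by rewrite sqrf_eq0 mulf_eq0 invr_eq0 (gt_eqF s1) orbF => /eqP.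
Qed.

(** A minimizing sequence for the distance to M is Cauchy by the parallelogram
    identity applied to midpoints; the first variation of the distance at the limit
    is the orthogonality relation. *)
Theorem orthogonal_projection (M : set H) x : subspace M -> adherent_closed M ->
  exists2 y, M y & forall m, M m -> inner (x - y) m = 0.
Proof.
move=> [M0 Mlin] Mcl.
pose D := [set hnorm (x - m) ^+ 2 | m in M]; pose d := inf D.
have D0 : D !=set0 by exists (hnorm (x - 0) ^+ 2); exists 0.
have lD : has_lbound D by exists 0 => _ [m _ <-]; exact: sqr_ge0.
have dle m : M m -> d <= hnorm (x - m) ^+ 2 by move=> Mm; apply: ge_inf => //; exists m.
have /choice[y hy] n : exists y, M y /\ hnorm (x - y) ^+ 2 < d + n.+1%:R^-1.
  have [|_ [m Mm <-] lt] := @inf_adherent R D n.+1%:R^-1 _ (conj D0 lD).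
    by rewrite invr_gt0.
  by exists m.
have MB u v (k : R) : M u -> M v -> M (u + k%:C *: v).
  by move=> Mu Mv; rewrite addrC; exact: Mlin.
have yc : forall e : R, 0 < e -> exists N, forall m n, (N <= m)%N -> (N <= n)%N ->
    hnorm (y m - y n) < e.
  move=> e e0; have e4 : 0 < e ^+ 2 / 4 by rewrite divr_gt0 ?exprn_gt0.
  have [N hN] := inv_succ_lt e4; exists N => m n Nm Nn.
  rewrite -(@ltr_pXn2r _ 2)// ?nnegrE ?hnorm_ge0 ?(ltW e0)//.
  have [Mm hm] := hy m; have [Mn hn] := hy n.
  have Mmid : M (2^-1%:C *: (y m + y n)).
    rewrite scalerDr; apply: (MB) => //.
    by have := Mlin (2^-1%:C) _ _ Mm M0; rewrite addr0.
  have := dle _ Mmid; have := hN _ Nm; have := hN _ Nn.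
  have -> : hnorm (y m - y n) ^+ 2 = 2 * hnorm (x - y m) ^+ 2 +
      2 * hnorm (x - y n) ^+ 2 - 4 * hnorm (x - 2^-1%:C *: (y m + y n)) ^+ 2.
    rewrite -!rdotxx !rdotE (rdotC (y n) (y m)) !(rdotC _ x); by field.
  move: hm hn; move: (hnorm _ ^+ 2) (hnorm _ ^+ 2) (hnorm _ ^+ 2) (e ^+ 2).
  move: (m.+1%:R^-1) (n.+1%:R^-1) => *; lra.
(* the limit of the minimizing sequence is the projection *)
have [l yl] := hilbert_complete yc.
have Ml : M l.
  apply: Mcl => e /yl[N hN]; exists (y N); first by case: (hy N).
  exact: hN.
exists l => // m Mm; suff r0 m' : M m' -> rdot (x - l) m' = 0.
  rewrite -(linear0l (@inner R H) m); apply: inner_ext => c; rewrite rdot0l r0//.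
  by have := Mlin c _ _ Mm M0; rewrite addr0.
move=> {m}Mm; rename m' into m.
apply: (@quadratic_vanish _ (hnorm m ^+ 2)); first exact: sqr_ge0.
move=> k; apply/ler_addgt0Pl => e e0.
have c0 : 0 < 2 * `|k| * hnorm m + 1.
  by rewrite ltr_wpDl ?mulr_ge0 ?hnorm_ge0.
have e2 : 0 < e / 2 by rewrite divr_gt0.
have [N1 h1] := inv_succ_lt e2; have [|N2 h2] := yl (e / 2 / (2 * `|k| * hnorm m + 1)).
  by rewrite divr_gt0.
pose n := maxn N1 N2; have := h1 _ (leq_maxl N1 N2); have := h2 _ (leq_maxr N1 N2).
rewrite -/n ltr_pdivlMr//; set dn := hnorm _ => hdn hn.
have [Mn lt] := hy n; have := dle _ (MB _ _ k Mn Mm).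
rewrite opprD addrA hnormBsq rdotZr hnormZr exprMn real_normK ?num_real//.
have -> : x - l = (x - y n) - (l - y n) by rewrite opprB addrA subrK.
rewrite (rdotBl (x - y n)).
have h3 : - (k * rdot (l - y n) m) <= `|k| * (dn * hnorm m).
  apply: le_trans (ler_norm _) _; rewrite normrN normrM.
  by rewrite ler_wpM2l// rdot_le.
have := hnorm_ge0 (l - y n); rewrite -/dn => dn0.
move: hn hdn lt h3; move: (n.+1%:R^-1) (hnorm _ ^+ 2) => i s.
rewrite (_ : dn * (2 * _ * _ + 1) = 2 * (`|k| * (dn * hnorm m)) + dn); last by ring.
rewrite (_ : 2 * k * _ = 2 * (k * rdot (x - y n) m) - 2 * (k * rdot (l - y n) m)); last by ring.
by move: (`|k| * (dn * hnorm m)) (k * rdot (x - y n) m) (k * rdot (l - y n) m) => *; lra.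
Qed.

(** If f is not zero, the orthogonal complement of its kernel is a line, spanned by
    the component w of any x0 with f x0 != 0; x - (f x / f w) w is in the kernel. *)
Lemma riesz (f : H -> R[i]) (K : R) :
  (forall k x y, f (k *: x + y) = k * f x + f y) ->
  (forall x, `|f x| <= (K * hnorm x)%:C) ->
  exists z, forall x, f x = inner x z.
Proof.
move=> flin fb.
have f0 : f 0 = 0.
  by have := flin (-1) 0 0; rewrite scaler0 addr0 mulN1r addNr.
have [fz|/existsNP[x0 /eqP fx0]] := pselect (forall x, f x = 0).
  by exists 0 => x; rewrite fz linear0r.
pose M := [set x | f x = 0].
have Ms : subspace M.
  by split=> // k x y fx fy; rewrite /M/= flin fx fy mulr0 addr0.
have Mc : adherent_closed M.
  move=> x hx; rewrite /M/=; apply/eqP; rewrite -normr_eq0.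
  have /complex_realP[r rE] := normr_real (f x).
  rewrite rE -[_ == _]/(r%:C == 0%:C) (inj_eq (@complexI R)); apply/eqP/le_anti/andP; split.
    apply/ler_addgt0Pl => e e0; rewrite addr0.
    have K0 : 0 < `|K| + 1 by rewrite ltr_wpDl.
    have [|m fm lt] := hx (e / (`|K| + 1)); first by rewrite divr_gt0.
    rewrite -lecR -rE; have -> : f x = f (x - m).
      by rewrite -[x - m]addrC -[- m]scaleN1r flin fm mulr0 add0r.
    apply: le_trans (fb _) _; rewrite lecR.
    apply: le_trans (_ : (`|K| + 1) * hnorm (x - m) <= _); last first.
      by rewrite mulrC -ler_pdivlMr// ltW.
    by rewrite ler_wpM2r ?hnorm_ge0// (le_trans (ler_norm _))// lerDl.
  by rewrite -lecR -rE; exact: normr_ge0.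
have [y fy hy] := orthogonal_projection x0 Ms Mc.
set w := x0 - y in hy; have fw : f w = f x0.
  by rewrite /w -[x0 - y]addrC -[- y]scaleN1r flin fy mulr0 add0r.
have w0 : inner w w != 0.
  apply: contra_neq fx0 => /eqP; rewrite dnorm_eq0 => /eqP w0.
  by rewrite -fw w0.
exists (Num.conj (f w / inner w w) *: w) => x.
rewrite linearZr_LR /= conjCK.
have := hy (x - (f x / f w) *: w).
rewrite /M/= -[x - _]addrC -scaleNr flin mulNr divfK ?fw// addNr => /(_ erefl).
rewrite linearDr /= linearZr_LR /= rmorphN mulNr => /eqP.
rewrite addrC subr_eq0 => /eqP e.
have : Num.conj (inner w x) = (f x / f x0) * inner w w.
  rewrite e rmorphM /= conjCK; congr (_ * _).
  by rewrite [RHS]hermC expr0 mul1r.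
have -> : Num.conj (inner w x) = inner x w by rewrite [RHS]hermC expr0 mul1r.
by move=> ->; field; rewrite fx0 w0.
Qed.
End Projection.

(** * Bounded operators and adjoints *)

Lemma subrACA (V : zmodType) (p q r s : V) : (p - q) - (r - s) = (p - r) - (q - s).
Proof. by rewrite !opprD !opprK addrACA. Qed.

Lemma subrBB (V : zmodType) (p q r : V) : (p - q) - (p - r) = r - q.
Proof. by rewrite opprB addrC subrKA. Qed.

Section Bounded.
Variables (R : realType) (H : hilbertType R).
Implicit Types (X Y : H -> H) (x y : H).

Lemma linear_op0 X : linear X -> X 0 = 0.
Proof. by move=> l; have := l (-1) 0 0; rewrite scaler0 addr0 scaleN1r addNr. Qed.

Lemma linear_opD X x y : linear X -> X (x + y) = X x + X y.
Proof. by move=> l; have := l 1 x y; rewrite !scale1r. Qed.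

Lemma linear_opZ X k x : linear X -> X (k *: x) = k *: X x.
Proof. by move=> l; have := l k x 0; rewrite (linear_op0 l) !addr0. Qed.

Lemma linear_opN X x : linear X -> X (- x) = - X x.
Proof. by move=> l; rewrite -scaleN1r (linear_opZ _ _ l) scaleN1r. Qed.

Lemma linear_opB X x y : linear X -> X (x - y) = X x - X y.
Proof. by move=> l; rewrite linear_opD// linear_opN. Qed.

Lemma bounded_opP X (K : R) : linear X -> (forall x, hnorm (X x) <= K * hnorm x) ->
  bounded_operator X.
Proof. by move=> ? ?; split=> //; exists K. Qed.

Lemma opnorm_le X (K : R) : 0 <= K -> (forall x, hnorm (X x) <= K * hnorm x) ->
  opnorm X <= K.
Proof.
move=> K0 h; apply: ge_sup; first by exists (hnorm (X 0)), 0 => //=; rewrite hnorm0.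
by move=> _ [x /= x1 <-]; apply: le_trans (h x) _; rewrite ler_piMr.
Qed.

Lemma has_sup_opnorm X : bounded_operator X ->
  has_sup [set hnorm (X x) | x in [set x | hnorm x <= 1]].
Proof.
move=> [lX [K hK]]; split; first by exists (hnorm (X 0)), 0 => //=; rewrite hnorm0.
exists `|K| => _ [x /= x1 <-]; apply: le_trans (hK x) _.
apply: (@le_trans _ _ (`|K| * hnorm x)); first by rewrite ler_wpM2r ?hnorm_ge0// ler_norm.
by rewrite ler_piMr.
Qed.

Lemma opnorm_ge0 X : bounded_operator X -> 0 <= opnorm X.
Proof.
move=> bX; apply: le_trans (hnorm_ge0 (X 0)) _; apply: ub_le_sup; last first.
  by exists 0 => //=; rewrite hnorm0.
by case: (has_sup_opnorm bX).
Qed.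

Lemma opnormP X x : bounded_operator X -> hnorm (X x) <= opnorm X * hnorm x.
Proof.
move=> bX; have [lX _] := bX.
have [->|x0] := eqVneq x 0; first by rewrite (linear_op0 lX) hnorm0 mulr0.
have nx : 0 < hnorm x by rewrite hnorm_gt0.
rewrite -ler_pdivrMr//.
have -> : hnorm (X x) / hnorm x = hnorm (X ((hnorm x)^-1%:C *: x)).
  by rewrite (linear_opZ _ _ lX) hnormZr ger0_norm ?invr_ge0 ?hnorm_ge0// mulrC.
apply: ub_le_sup; first by case: (has_sup_opnorm bX).
exists ((hnorm x)^-1%:C *: x) => //=.
by rewrite hnormZr ger0_norm ?invr_ge0 ?hnorm_ge0// mulVf ?gt_eqF.
Qed.

(** Riesz' theorem shows that [adjoint] does not take its default value. *)
Lemma adjointP X x y : bounded_operator X -> inner (X x) y = inner x (adjoint X y).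
Proof.
move=> bX; have [lX _] := bX.
have [|x'|z hz] := @riesz R H (fun x => inner (X x) y) (opnorm X * hnorm y).
- by move=> k u v; rewrite lX linearDl /= linearZl_LR.
- apply: le_trans (norm_inner_le _ _) _; rewrite lecR mulrAC.
  by rewrite ler_wpM2r ?hnorm_ge0// opnormP.
have h : exists z, [set z | forall x, inner (X x) y = inner x z] z by exists z.
exact: (xgetPex 0 h).
Qed.

Lemma rdot_adjoint X x y : bounded_operator X -> rdot (X x) y = rdot x (adjoint X y).
Proof. by move=> bX; rewrite /rdot adjointP. Qed.

Lemma adjointPr X x y : bounded_operator X -> inner x (X y) = inner (adjoint X x) y.
Proof.
move=> bX; rewrite [LHS]hermC [RHS]hermC; congr (_ * Num.conj _).
exact: adjointP.
Qed.

Lemma inner_inj x y : (forall z, inner z x = inner z y) -> x = y.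
Proof.
move=> h; apply/eqP; rewrite -subr_eq0 -(dnorm_eq0 (@inner R H)).
by rewrite linearBr /= h subrr.
Qed.

Lemma adjoint_linear X : bounded_operator X -> linear (adjoint X).
Proof.
move=> bX k x y; apply: inner_inj => z.
by rewrite linearDr /= linearZr_LR /= -!adjointP// linearDr /= linearZr_LR.
Qed.

Lemma adjoint_le X x : bounded_operator X -> hnorm (adjoint X x) <= opnorm X * hnorm x.
Proof.
move=> bX; have [->|n0] := eqVneq (adjoint X x) 0.
  by rewrite hnorm0 mulr_ge0 ?opnorm_ge0 ?hnorm_ge0.
have n1 : 0 < hnorm (adjoint X x) by rewrite hnorm_gt0.
rewrite -(ler_pM2l n1) -expr2 -rdotxx -rdot_adjoint//.
apply: le_trans (ler_rdot _ _) _; rewrite mulrA ler_wpM2r ?hnorm_ge0//.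
by rewrite mulrC opnormP.
Qed.

Lemma adjoint_bounded X : bounded_operator X -> bounded_operator (adjoint X).
Proof.
move=> bX; apply: (bounded_opP (K := opnorm X)); first exact: adjoint_linear.
by move=> x; exact: adjoint_le.
Qed.

Lemma bounded_comp X Y : bounded_operator X -> bounded_operator Y ->
  bounded_operator (X \o Y).
Proof.
move=> bX bY; have [lX _] := bX; have [lY _] := bY.
apply: (bounded_opP (K := opnorm X * opnorm Y)) => [k x y|x] /=; first by rewrite lY lX.
by apply: le_trans (opnormP _ bX) _; rewrite -mulrA ler_wpM2l ?opnorm_ge0// opnormP.
Qed.

Lemma bounded_sub X Y : bounded_operator X -> bounded_operator Y ->
  bounded_operator (X \- Y).
Proof.
move=> bX bY; have [lX _] := bX; have [lY _] := bY.
apply: (bounded_opP (K := opnorm X + opnorm Y)) => [k x y|x] /=.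
  by rewrite lY lX scalerBr opprD addrACA.
by apply: le_trans (ler_hnormB _ _) _; rewrite mulrDl lerD ?opnormP.
Qed.

End Bounded.

(** * Self-adjoint graphs and their resolvents *)

Section Resolvent.
Variables (R : realType) (K : hilbertType R).
Implicit Types (T : set (K * K)) (u v w : K) (z : R[i]).

Lemma adjoint_graph_lin T (k : R[i]) p q : adjoint_graph T p -> adjoint_graph T q ->
  adjoint_graph T (k *: p + q).
Proof.
move=> hp hq u v Tuv /=.
by rewrite !linearDr /= !linearZr_LR /= (hp _ _ Tuv) (hq _ _ Tuv).
Qed.

Lemma adjoint_graph0 T : adjoint_graph T 0.
Proof. by move=> u v _; rewrite /= !linear0r. Qed.

Lemma adjoint_graph_closed T u v :
  (forall e : R, 0 < e -> exists u' v', [/\ adjoint_graph T (u', v'),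
     hnorm (u - u') < e & hnorm (v - v') < e]) -> adjoint_graph T (u, v).
Proof.
move=> h f g Tfg /=; apply: inner_ext => c; apply/eqP; rewrite -subr_eq0 -normr_le0.
apply/ler_addgt0Pl => e e0; rewrite addr0.
pose M := complex.Re `|c| * (hnorm f + hnorm g) + 1.
have cn : 0 <= complex.Re `|c| by rewrite -ler0c RRe_real ?normr_real.
have M0 : 0 < M by rewrite ltr_wpDl// mulr_ge0// addr_ge0 ?hnorm_ge0.
have [|u' [v' [T' hu hv]]] := h (e / M); first by rewrite divr_gt0.
have := T' _ _ Tfg => /= eq.
have eqc : rdot g (c *: u') = rdot f (c *: v') by rewrite /rdot !linearZr_LR /= eq.
have -> : rdot g (c *: u) - rdot f (c *: v) =
    rdot g (c *: (u - u')) - rdot f (c *: (v - v')).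
  by rewrite !scalerBr !rdotBr eqc; ring.
apply: le_trans (ler_normB _ _) _.
apply: (@le_trans _ _
  (complex.Re `|c| * (hnorm g * hnorm (u - u') + hnorm f * hnorm (v - v')))).
  rewrite mulrDr lerD//; apply: le_trans (rdot_le _ _) _; rewrite hnormZ;
  by rewrite mulrCA.
apply: (@le_trans _ _ (M * (e / M))); last by rewrite mulrC divfK ?gt_eqF.
have := hnorm_ge0 f; have := hnorm_ge0 g; move: hu hv.
move: (hnorm_ge0 (u - u')) (hnorm_ge0 (v - v')); move: (e / M); rewrite /M => d.
move: (hnorm f) (hnorm g) (hnorm _) (hnorm _) => F G U V U0 V0 hu hv G0 F0.
apply: (@le_trans _ _ (complex.Re `|c| * (G * d + F * d))).
  by rewrite ler_wpM2l// lerD// ler_wpM2l// ltW.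
have d0 : 0 <= d by apply: le_trans U0 (ltW _).
by rewrite -subr_ge0 (_ : _ - _ = d)//; ring.
Qed.

Lemma symmetric_form_real T u v : T `<=` adjoint_graph T -> T (u, v) ->
  complex.Im (inner v u) = 0.
Proof.
move=> sT Tuv; have := sT _ Tuv _ _ Tuv => /= e.
have : Num.conj (inner v u) = inner v u by rewrite {2}e [RHS]hermC expr0 mul1r.
rewrite conjCE; case: (inner v u) => p q [] /eqP; rewrite eq_sym -subr_eq0 opprK.
by rewrite -mulr2n mulrn_eq0 => /eqP.
Qed.

(** The imaginary part of <v - z u, u> is - Im z |u|^2, as <v, u> is real. *)
Lemma symmetric_bounded_below T u v z : T `<=` adjoint_graph T -> T (u, v) ->
  `|complex.Im z| * hnorm u <= hnorm (v - z *: u).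
Proof.
move=> sT Tuv; have [->|u0] := eqVneq u 0; first by rewrite hnorm0 mulr0 hnorm_ge0.
have nu : 0 < hnorm u by rewrite hnorm_gt0.
rewrite -(ler_pM2r nu) -mulrA -expr2.
have : complex.Im (inner (v - z *: u) u) = - (complex.Im z * hnorm u ^+ 2).
  rewrite linearBl /= linearZl_LR /= inner_normE.
  have := symmetric_form_real sT Tuv; case: (inner v u) z => [p q] [r s] /= ->.
  by rewrite mulr0 !add0r.
have : `|complex.Im (inner (v - z *: u) u)| <= hnorm (v - z *: u) * hnorm u.
  rewrite Im_inner; apply: le_trans (rdot_le _ _) _.
  by rewrite hnormZ normc_def /= expr0n expr1n add0r sqrtr1 mul1r.
by move=> h e; move: h; rewrite e normrN normrM (ger0_norm (sqr_ge0 _)).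
Qed.

(** The range of T - z is closed because T is closed and T - z is bounded below.  A
    vector y orthogonal to it satisfies <v, y> = <u, z^* y> on T, so (y, z^* y) is
    in T and y = 0.  Hence the range is the whole space. *)
Lemma resolvent_exists T z (c : R) : T = adjoint_graph T -> 0 < c ->
  (forall u v, T (u, v) -> c * hnorm u <= hnorm (v - z *: u)) ->
  (forall u, T (u, Num.conj z *: u) -> u = 0) ->
  exists B, is_resolvent T z B.
Proof.
move=> aT c0 bb inj.
have Tl k p q : T p -> T q -> T (k *: p + q) by rewrite aT; exact: adjoint_graph_lin.
have T0 : T 0 by rewrite aT; exact: adjoint_graph0.
have TB p q : T p -> T q -> T (p - q).
  by move=> Tp Tq; rewrite addrC -scaleN1r; exact: Tl.
pose M := [set w | exists u v, T (u, v) /\ w = v - z *: u].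
have Ms : subspace M.
  split; first by exists 0, 0; rewrite scaler0 subr0.
  move=> k _ _ [u [v [Tu ->]]] [u' [v' [Tu' ->]]].
  exists (k *: u + u'), (k *: v + v'); split; first exact: (Tl k _ _ Tu Tu').
  by rewrite scalerBr scalerDr !scalerA (mulrC z) opprD addrACA.
have Mc : adherent_closed M.
  move=> w hw.
  have /choice[f hf] n : exists p : K * K, T p /\ hnorm (w - (p.2 - z *: p.1)) < n.+1%:R^-1.
    have [|_ [u [v [Tu ->]]] lt] := hw (n.+1%:R^-1); first by rewrite invr_gt0.
    by exists (u, v).
  have fc : forall e : R, 0 < e -> exists N, forall m n, (N <= m)%N -> (N <= n)%N ->
      hnorm ((f m).1 - (f n).1) < e.
    move=> e e0; have e1 : 0 < c * e / 2 by rewrite divr_gt0 ?mulr_gt0.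
    have [N hN] := inv_succ_lt e1; exists N => m n Nm Nn.
    have [Tm lm] := hf m; have [Tn ln] := hf n.
    rewrite -(ltr_pM2l c0); apply: le_lt_trans (bb _ ((f m).2 - (f n).2) _) _.
      by have := TB _ _ Tm Tn; case: (f m) (f n) => [? ?] [].
    have -> : (f m).2 - (f n).2 - z *: ((f m).1 - (f n).1) =
        (w - ((f n).2 - z *: (f n).1)) - (w - ((f m).2 - z *: (f m).1)).
      by rewrite subrBB scalerBr subrACA.
    apply: le_lt_trans (ler_hnormB _ _) _.
    by rewrite [ltRHS](splitr (c * e)) ltrD// ?(lt_trans ln (hN _ Nn)) ?(lt_trans lm (hN _ Nm)).
  have [u hu] := hilbert_complete fc.
  exists u, (w + z *: u); split; last by rewrite addrK.
  rewrite aT; apply: adjoint_graph_closed => e e0.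
  have zn : 0 <= complex.Re `|z| by rewrite -ler0c RRe_real ?normr_real.
  have e2 : 0 < e / 2 by rewrite divr_gt0.
  have M0 : 0 < complex.Re `|z| + 1 by rewrite ltr_wpDl.
  have [N1 h1] := inv_succ_lt e2; have [|N2 h2] := hu (e / 2 / (complex.Re `|z| + 1)).
    by rewrite divr_gt0.
  pose n := maxn N1 N2; have := h1 _ (leq_maxl N1 N2); have := h2 _ (leq_maxr N1 N2).
  rewrite -/n => hun i2; have [Tn ln] := hf n.
  exists (f n).1, (f n).2; rewrite -aT; split; first by case: (f n) Tn.
    apply: lt_le_trans hun _; rewrite ler_pdivrMr//.
    by nra.
  have -> : w + z *: u - (f n).2 = (w - ((f n).2 - z *: (f n).1)) + z *: (u - (f n).1).
    by rewrite scalerBr opprB -[RHS]addrA [X in _ = _ + X]addrC subrKA addrA.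
  apply: le_lt_trans (ler_hnormD _ _) _; rewrite hnormZ.
  rewrite [ltRHS](splitr e) ltrD//; first exact: lt_trans ln i2.
  move: hun; rewrite ltr_pdivlMr//; apply: le_lt_trans.
  by rewrite mulrC ler_wpM2l ?hnorm_ge0// lerDl.
have full w : M w.
  have [y My hy] := orthogonal_projection w Ms Mc.
  suff : w - y = 0 by move/eqP; rewrite subr_eq0 => /eqP ->.
  apply: inj; rewrite aT => u v Tuv /=; apply/eqP; rewrite linearZr_LR /= conjCK.
  rewrite -linearZl_LR -subr_eq0 -linearBl; apply/eqP.
  have : inner (w - y) (v - z *: u) = 0 by apply: hy; exists u, v.
  by move=> e; rewrite [LHS]hermC /= e rmorph0 mulr0.
have /choice[B hB] w : exists u, T (u, w + z *: u).
  by have [u [v [Tu ->]]] := full w; exists u; rewrite subrK.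
have uniq u v u' v' : T (u, v) -> T (u', v') -> v - z *: u = v' - z *: u' -> u = u'.
  move=> Tu Tu' e; apply/eqP; rewrite -subr_eq0 -hnorm_eq0; apply/eqP/le_anti.
  rewrite hnorm_ge0 andbT -(ler_pM2l c0) mulr0; apply: le_trans (bb _ (v - v') _) _.
    exact: (TB _ _ Tu Tu').
  by rewrite scalerBr subrACA e subrr hnorm0.
exists B; split; first apply: (bounded_opP (K := c^-1)).
- move=> k x y; apply: (uniq _ _ _ _ (hB _) (Tl k _ _ (hB x) (hB y))) => /=.
  by rewrite addrK !scalerDr !scalerA (mulrC z) opprD addrACA addrK addrK.
- move=> x; rewrite mulrC ler_pdivlMr// mulrC; apply: le_trans (bb _ _ (hB x)) _.
  by rewrite addrK.
move=> u v; split=> [Tu|e]; first by apply: (uniq _ _ _ _ Tu (hB _)); rewrite addrK.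
by have := hB (v - z *: u); rewrite -e subrK.
Qed.

Lemma selfadjoint_spectrum_real T z : T = adjoint_graph T -> spectrum T z ->
  complex.Im z = 0.
Proof.
move=> aT sz; apply: contrapT => /eqP z0; apply: sz.
have sT : T `<=` adjoint_graph T by rewrite -aT.
apply: (resolvent_exists (c := `|complex.Im z|) aT); first by rewrite normr_gt0.
  by move=> u v; exact: symmetric_bounded_below.
move=> u /(symmetric_bounded_below (Num.conj z) sT).
rewrite subrr hnorm0 conjCE (_ : complex.Im _ = - complex.Im z); last by case: (z).
rewrite normrN pmulr_rle0 ?normr_gt0// => u0.
by apply/eqP; rewrite -hnorm_eq0 eq_le u0 hnorm_ge0.
Qed.

Lemma selfadjoint_eigenvalue_real T z u : T = adjoint_graph T -> u != 0 ->
  T (u, z *: u) -> complex.Im z = 0.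
Proof.
move=> aT u0 /(symmetric_bounded_below z); rewrite subrr hnorm0 -aT => /(_ (fun=> id)).
by rewrite pmulr_lle0 ?hnorm_gt0// normr_le0 => /eqP.
Qed.

End Resolvent.

(** * Polynomials of an operator *)

Section PolyOperator.
Variables (R : realType) (H : hilbertType R) (X : H -> H).
Hypothesis lX : linear X.
Implicit Types (p q : {poly R[i]}) (x y : H).

(** The complex counterpart of [poly_operator]: real polynomials factor into linear
    ones only over the complex numbers. *)
Definition cpoly_operator p x : H := \sum_(i < size p) p`_i *: iter i X x.

Lemma cpoly_operator_widen n p x : (size p <= n)%N ->
  cpoly_operator p x = \sum_(i < n) p`_i *: iter i X x.
Proof.
move=> pn; rewrite /cpoly_operator (big_ord_widen _ (fun i => p`_i *: iter i X x) pn).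
rewrite big_mkcond; apply: eq_bigr => i _; case: ltnP => // pi.
by rewrite nth_default// scale0r.
Qed.

Lemma cpoly_operatorD p q x :
  cpoly_operator (p + q) x = cpoly_operator p x + cpoly_operator q x.
Proof.
have h1 := leq_maxl (size p) (size q); have h2 := leq_maxr (size p) (size q).
rewrite (cpoly_operator_widen _ h1) (cpoly_operator_widen _ h2).
rewrite (cpoly_operator_widen _ (size_polyD p q)) -big_split.
by apply: eq_bigr => i _; rewrite coefD scalerDl.
Qed.

Lemma cpoly_operatorC c x : cpoly_operator c%:P x = c *: x.
Proof.
by rewrite (cpoly_operator_widen _ (size_polyC_leq1 c)) big_ord_recl big_ord0 addr0 coefC.
Qed.

Lemma cpoly_operator0 x : cpoly_operator 0 x = 0.
Proof. by rewrite -(scale0r x) -cpoly_operatorC. Qed.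

Lemma cpoly_operator1 x : cpoly_operator 1 x = x.
Proof. by rewrite -[RHS]scale1r -cpoly_operatorC. Qed.

Lemma cpoly_operatorMX p x : cpoly_operator (p * 'X) x = cpoly_operator p (X x).
Proof.
have sp : (size (p * 'X)%R <= (size p).+1)%N.
  by apply: leq_trans (size_polyMleq _ _) _; rewrite size_polyX addn2.
rewrite (cpoly_operator_widen _ sp) big_ord_recl coefMX eqxx scale0r add0r.
by apply: eq_bigr => i _; rewrite coefMX -iterSr.
Qed.

Lemma iter_linear n : linear (iter n X).
Proof. by elim: n => [|n IH] k x y //=; rewrite IH lX. Qed.

Lemma cpoly_operator_linear p : linear (cpoly_operator p).
Proof.
move=> k x y; rewrite /cpoly_operator scaler_sumr -big_split.
apply: eq_bigr => i _; rewrite iter_linear scalerDr !scalerA.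
by rewrite [k * _]mulrC.
Qed.

Lemma cpoly_operatorM p q x :
  cpoly_operator (p * q) x = cpoly_operator p (cpoly_operator q x).
Proof.
elim/poly_ind: q x => [|q c IH] x.
  rewrite mulr0 !cpoly_operator0.
  by rewrite (linear_op0 (cpoly_operator_linear p)).
rewrite mulrDr mulrA !cpoly_operatorD !cpoly_operatorMX IH [_ * c%:P]mulrC.
rewrite (linear_opD _ _ (cpoly_operator_linear p)); congr (_ + _).
rewrite cpoly_operatorC (linear_opZ _ _ (cpoly_operator_linear p)).
rewrite mul_polyC (@cpoly_operator_widen (size p)) ?size_scale_leq//.
by rewrite /cpoly_operator scaler_sumr; apply: eq_bigr => i _; rewrite coefZ scalerA.
Qed.

Lemma poly_operatorE (p : {poly R}) x :
  poly_operator p X x = cpoly_operator (map_poly (real_complex R) p) x.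
Proof.
rewrite /poly_operator /cpoly_operator size_map_poly.
by apply: eq_bigr => i _; rewrite coef_map.
Qed.

Lemma poly_operatorD (p q : {poly R}) x :
  poly_operator (p + q) X x = poly_operator p X x + poly_operator q X x.
Proof. by rewrite !poly_operatorE rmorphD cpoly_operatorD. Qed.

Lemma poly_operatorM (p q : {poly R}) x :
  poly_operator (p * q) X x = poly_operator p X (poly_operator q X x).
Proof. by rewrite !poly_operatorE rmorphM cpoly_operatorM. Qed.

Lemma poly_operatorC (c : R) x : poly_operator c%:P X x = c%:C *: x.
Proof. by rewrite poly_operatorE map_polyC cpoly_operatorC. Qed.

Lemma poly_operator0 x : poly_operator 0 X x = 0.
Proof. by rewrite -(scale0r x) -poly_operatorC. Qed.

Lemma poly_operatorX x : poly_operator 'X X x = X x.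
Proof.
rewrite poly_operatorE map_polyX -['X]mul1r cpoly_operatorMX.
by rewrite cpoly_operator1.
Qed.

Lemma poly_operatorN (p : {poly R}) x : poly_operator (- p) X x = - poly_operator p X x.
Proof.
by rewrite -mulN1r -polyCN poly_operatorM poly_operatorC rmorphN scaleN1r.
Qed.

Lemma poly_operator_linear (p : {poly R}) : linear (poly_operator p X).
Proof. by move=> k x y; rewrite !poly_operatorE cpoly_operator_linear. Qed.

Lemma poly_operator_bounded (p : {poly R}) : bounded_operator X ->
  bounded_operator (poly_operator p X).
Proof.
move=> bX; split; first exact: poly_operator_linear.
elim/poly_ind: p => [|p c [K hK]].
  by exists 0 => x; rewrite poly_operator0 hnorm0 mul0r.
exists (`|K| * opnorm X + `|c|) => x.
rewrite poly_operatorD poly_operatorM poly_operatorX poly_operatorC mulrDl.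
apply: le_trans (ler_hnormD _ _) _; rewrite hnormZr lerD//.
apply: le_trans (hK _) _; rewrite -mulrA.
apply: (@le_trans _ _ (`|K| * hnorm (X x))).
  by rewrite ler_wpM2r ?hnorm_ge0// ler_norm.
by rewrite ler_wpM2l// opnormP.
Qed.

Definition symmetric_operator := forall x y, inner (X x) y = inner x (X y).

Lemma rdot_poly_operator (p : {poly R}) x y : symmetric_operator ->
  rdot (poly_operator p X x) y = rdot x (poly_operator p X y).
Proof.
move=> sX; elim/poly_ind: p x y => [|p c IH] x y.
  by rewrite !poly_operator0 rdot0l rdot0r.
rewrite !poly_operatorD [p * 'X]mulrC !poly_operatorM !poly_operatorX !poly_operatorC.
rewrite !rdotE; congr (_ + _); rewrite [LHS]/rdot sX -[LHS]/(rdot _ _) IH.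
by rewrite -[in LHS]poly_operatorX -[in RHS]poly_operatorX -!poly_operatorM mulrC.
Qed.

(** For self-adjoint operators, the spectrum is the set of the z for which X - z is
    not bounded below; this is how spectral points are detected here. *)
Definition bounded_below (Y : H -> H) := exists2 d : R, 0 < d &
  forall x, d * hnorm x <= hnorm (Y x).

Lemma bounded_below_comp Y Z : bounded_below Y -> bounded_below Z ->
  bounded_below (Y \o Z).
Proof.
move=> [d d0 hd] [e e0 he]; exists (d * e) => [|x]; first exact: mulr_gt0.
by apply: le_trans (hd _); rewrite -mulrA ler_wpM2l// ltW.
Qed.

Lemma bounded_below_poly p : p != 0 ->
  (forall c, root p c -> bounded_below (fun x => X x - c *: x)) ->
  bounded_below (cpoly_operator p).
Proof.
move=> p0 hp; have [r pE] := closed_field_poly_normal p.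
have hr c : c \in r -> bounded_below (fun x => X x - c *: x).
  by move=> cr; apply: hp; rewrite pE rootZ ?lead_coef_eq0// root_prod_XsubC.
have {pE} -> : cpoly_operator p =
    cpoly_operator (lead_coef p)%:P \o cpoly_operator (\prod_(z <- r) ('X - z%:P)).
  by apply/funext => x; rewrite /= -cpoly_operatorM mul_polyC -pE.
apply: bounded_below_comp.
  exists (complex.Re `|lead_coef p|) => [|x]; last by rewrite cpoly_operatorC hnormZ.
  by rewrite -(ltcR 0) RRe_real ?normr_real// normr_gt0 lead_coef_eq0.
elim: r hr => [|c r IH] hr.
  by exists 1 => // x; rewrite big_nil cpoly_operator1 mul1r.
rewrite big_cons.
have -> : cpoly_operator (('X - c%:P) * \prod_(j <- r) ('X - j%:P)) =
    (fun x => X x - c *: x) \o cpoly_operator (\prod_(j <- r) ('X - j%:P)).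
  apply/funext => x; rewrite cpoly_operatorM /= -['X]mul1r -polyCN cpoly_operatorD.
  by rewrite cpoly_operatorMX cpoly_operator1 cpoly_operatorC scaleNr.
apply: bounded_below_comp; first by apply: hr; rewrite mem_head.
by apply: IH => z zr; apply: hr; rewrite in_cons zr orbT.
Qed.

End PolyOperator.

(** * The spectrum and the quadratic form of a symmetric operator *)

Section SpectralPositivity.
Variables (R : realType) (H : hilbertType R) (X : H -> H).
Hypotheses (bX : bounded_operator X) (sX : symmetric_operator X).
Implicit Types (p q : {poly R}) (x y : H) (t : R).

Let lX : linear X := proj1 bX.

Lemma graph_symmetric : graph X `<=` adjoint_graph (graph X).
Proof. by move=> [u v]; rewrite /graph/= => -> u' v' /= ->; exact: sX. Qed.

Lemma graph_selfadjoint : graph X = adjoint_graph (graph X).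
Proof.
apply/seteqP; split; first exact: graph_symmetric.
move=> [u v] /= h; apply: inner_inj => x.
by rewrite -sX; have := h x (X x) erefl => /= <-.
Qed.

Lemma resolvent_bounded_below (z : R[i]) : ~ spectrum (graph X) z ->
  bounded_below (fun x => X x - z *: x).
Proof.
move=> /contrapT[B [[lB [K hK]] hB]].
have K0 : 0 < `|K| + 1 by rewrite ltr_wpDl.
exists (`|K| + 1)^-1 => [|x]; first by rewrite invr_gt0.
rewrite mulrC ler_pdivrMr// mulrC.
have {1}-> : x = B (X x - z *: x) by apply/hB.
apply: le_trans (hK _) _; rewrite ler_wpM2r ?hnorm_ge0//.
by rewrite (le_trans (ler_norm _))// lerDl.
Qed.

Lemma nonreal_bounded_below (z : R[i]) : complex.Im z != 0 ->
  bounded_below (fun x => X x - z *: x).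
Proof.
move=> z0; exists `|complex.Im z| => [|x]; first by rewrite normr_gt0.
exact: (symmetric_bounded_below z graph_symmetric).
Qed.

Lemma spectrum_le_norm t (K : R) : (forall x, hnorm (X x) <= K * hnorm x) ->
  spectrum (graph X) t%:C -> `|t| <= K.
Proof.
move=> hK st; rewrite leNgt; apply/negP => Kt; apply: st.
have bb u v : graph X (u, v) -> (`|t| - K) * hnorm u <= hnorm (v - t%:C *: u).
  rewrite /graph/= => ->; rewrite mulrBl -hnormZr hdistC.
  rewrite lerBlDr (le_trans _ (lerD (lexx _) (hK u)))//.
  by rewrite -{1}(subrK (X u) (t%:C *: u)) ler_hnormD.
apply: (resolvent_exists graph_selfadjoint _ bb); first by rewrite subr_gt0.
move=> u; rewrite conjCE conjc_real => /bb; rewrite subrr hnorm0.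
rewrite pmulr_rle0 ?subr_gt0// => u0; apply/eqP; rewrite -hnorm_eq0.
by rewrite eq_le u0 hnorm_ge0.
Qed.

(** Put S = Q - m >= 0.  Evaluating the form of S at x - S x / K, where K bounds S,
    gives <S x, x> >= |S x|^2 / K.  So a lower bound on |S x| would improve the
    infimum m. *)
Lemma inf_form_not_bounded_below (Q : H -> H) (x0 : H) :
  bounded_operator Q -> (forall x y, rdot (Q x) y = rdot x (Q y)) -> x0 != 0 ->
  exists m : R, (forall x, m * hnorm x ^+ 2 <= rdot (Q x) x) /\
    ~ bounded_below (fun x => Q x - m%:C *: x).
Proof.
move=> bQ sQ x00; have [lQ _] := bQ.
pose D := [set rdot (Q x) x | x in [set x | hnorm x = 1]]; pose m := inf D.
have nrm x : x != 0 -> hnorm ((hnorm x)^-1%:C *: x) = 1.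
  rewrite -hnorm_gt0 => x1.
  by rewrite hnormZr ger0_norm ?invr_ge0 ?hnorm_ge0// mulVf ?gt_eqF.
have D0 : D !=set0.
  pose y0 := (hnorm x0)^-1%:C *: x0.
  by exists (rdot (Q y0) y0), y0 => //=; rewrite nrm.
have lD : lbound D (- opnorm Q).
  move=> _ [x /= x1 <-]; rewrite lerNl; apply: le_trans (ler_norm _) _; rewrite normrN.
  apply: le_trans (rdot_le _ _) _; rewrite x1 mulr1.
  by have := opnormP x bQ; rewrite x1 mulr1.
have form_ge (c : R) x : (forall x, hnorm x = 1 -> c <= rdot (Q x) x) ->
    c * hnorm x ^+ 2 <= rdot (Q x) x.
  move=> hc; have [->|xn] := eqVneq x 0; first by rewrite hnorm0 expr0n mulr0 rdot0r.
  have := hc _ (nrm x xn); rewrite (linear_opZ _ _ lQ) rdotZl rdotZr mulrA -expr2.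
  by rewrite exprVn mulrC -ler_pdivlMr ?invr_gt0 ?exprn_gt0 ?hnorm_gt0// invrK.
have hm x : m * hnorm x ^+ 2 <= rdot (Q x) x.
  by apply: form_ge => y y1; apply: ge_inf; [exists (- opnorm Q)|exists y].
exists m; split => // -[d d0 hd].
pose S x := Q x - m%:C *: x; pose K := opnorm Q + `|m| + 1.
have K0 : 0 < K by rewrite ltr_wpDl// addr_ge0 ?opnorm_ge0.
have S0 x : 0 <= rdot (S x) x by rewrite /S rdotBl rdotZl rdotxx subr_ge0.
have SK x : hnorm (S x) <= K * hnorm x.
  apply: le_trans (ler_hnormB _ _) _; rewrite hnormZr.
  have := opnormP x bQ; rewrite /K mulrDl mul1r mulrDl => h.
  by rewrite -addrA lerD// lerDl hnorm_ge0.
have SS x : K^-1 * hnorm (S x) ^+ 2 <= rdot (S x) x.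
  have := S0 (x - K^-1%:C *: S x).
  have -> : S (x - K^-1%:C *: S x) = S x - K^-1%:C *: S (S x).
    rewrite {1 3}/S (linear_opB _ _ lQ) (linear_opZ _ _ lQ) !scalerBr.
    rewrite subrACA; congr (_ - (_ - _)).
    by rewrite !scalerA [(m%:C) * _]mulrC.
  rewrite rdotBl !rdotBr !rdotZl !rdotZr rdotxx.
  have -> : rdot (S (S x)) x = hnorm (S x) ^+ 2.
    by rewrite {1}/S rdotBl rdotZl sQ -rdotZr -rdotBr rdotxx.
  have : K^-1 * rdot (S (S x)) (S x) <= hnorm (S x) ^+ 2.
    rewrite mulrC ler_pdivrMr//; apply: le_trans (ler_rdot _ _) _.
    rewrite (_ : _ ^+ 2 * K = (K * hnorm (S x)) * hnorm (S x)); last by ring.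
    by rewrite ler_wpM2r ?hnorm_ge0.
  move=> h1; have k0 : 0 <= K^-1 by rewrite invr_ge0 ltW.
  have := ler_wpM2l k0 h1.
  by move: (K^-1 * (K^-1 * _)) (K^-1 * _ ^+ 2) => *; lra.
have : m + K^-1 * d ^+ 2 <= m.
  apply: lb_le_inf => // _ [x /= x1 <-].
  have := SS x; rewrite {2}/S rdotBl rdotZl rdotxx x1 expr1n mulr1 lerBrDl; apply: le_trans.
  rewrite lerD2l ler_wpM2l ?invr_ge0 ?(ltW K0)// ler_sqr ?nnegrE ?hnorm_ge0 ?(ltW d0)//.
  by have := hd x; rewrite x1 mulr1.
by rewrite gerDl leNgt mulr_gt0 ?invr_gt0 ?exprn_gt0.
Qed.

(** For nonconstant q, q - m has a root in the spectrum; the case q = 'X shows that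
    the spectrum is nonempty, which settles constant polynomials later. *)
Lemma spectral_minimum q (x0 : H) : x0 != 0 -> (1 < size q)%N ->
  exists2 t, spectrum (graph X) t%:C &
    forall x, q.[t] * hnorm x ^+ 2 <= rdot (poly_operator q X x) x.
Proof.
move=> x00 sq.
have [|||m [hm nb]] := @inf_form_not_bounded_below (poly_operator q X) x0 => //.
- exact: poly_operator_bounded.
- by move=> x y; exact: rdot_poly_operator.
apply: contrapT => nt; apply: nb.
pose p := map_poly (real_complex R) (q - m%:P).
have p0 : p != 0.
  rewrite map_poly_eq0 subr_eq0; apply: contraTneq sq => ->.
  by rewrite -leqNgt size_polyC_leq1.
have [d d0 hd] : bounded_below (cpoly_operator X p).
  apply: bounded_below_poly => // c pc.
  have [c0|] := eqVneq (complex.Im c) 0; last exact: nonreal_bounded_below.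
  apply: resolvent_bounded_below => sc; apply: nt.
  have cE : c = (complex.Re c)%:C by case: c c0 {pc sc} => a b /= ->.
  exists (complex.Re c); first by rewrite -cE.
  move: pc; rewrite cE /root horner_map fmorph_eq0 hornerD hornerN hornerC subr_eq0.
  by move=> /eqP ->.
exists d => // x; apply: le_trans (hd x) _.
by rewrite -poly_operatorE poly_operatorD// poly_operatorN// poly_operatorC.
Qed.

Lemma poly_operator_ge q (c : R) : (forall t, spectrum (graph X) t%:C -> c <= q.[t]) ->
  forall x, c * hnorm x ^+ 2 <= rdot (poly_operator q X x) x.
Proof.
move=> hq x; have [->|x0] := eqVneq x 0; first by rewrite hnorm0 expr0n mulr0 rdot0r.
have [sq|] := ltnP 1 (size q).
  have [t st ht] := spectral_minimum x0 sq; apply: le_trans (ht x).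
  by rewrite ler_wpM2r ?sqr_ge0 ?hq.
move=> /size1_polyC; move: (q`_0) => k qE.
have [|t st _] := @spectral_minimum 'X x x0; first by rewrite size_polyX.
rewrite qE poly_operatorC rdotZl rdotxx ler_wpM2r ?sqr_ge0//.
by have := hq _ st; rewrite qE hornerC.
Qed.

(** |q(X) x|^2 is the form of q^2(X), and - q^2 >= - e^2 on the spectrum. *)
Lemma poly_operator_le q (e : R) : 0 <= e ->
  (forall t, spectrum (graph X) t%:C -> `|q.[t]| <= e) ->
  forall x, hnorm (poly_operator q X x) <= e * hnorm x.
Proof.
move=> e0 hq x; rewrite -(@ler_pXn2r _ 2)// ?nnegrE ?mulr_ge0 ?hnorm_ge0//.
have hq2 t : spectrum (graph X) t%:C -> - e ^+ 2 <= (- q ^+ 2).[t].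
  move=> st; rewrite hornerN lerN2 horner_exp -real_normK ?num_real//.
  by rewrite ler_sqr ?nnegrE//; exact: hq.
have := poly_operator_ge hq2 x; rewrite poly_operatorN// rdotNl mulNr lerN2 expr2 poly_operatorM//.
by rewrite rdot_poly_operator// rdotxx exprMn.
Qed.

End SpectralPositivity.

(** * The negative part *)

Section NegativePart.
Variable R : realType.

(** Newton-like iteration for the square root of t^2: the polynomials increase to |t|
    on [-1, 1]. *)
Fixpoint abs_poly (n : nat) : {poly R} :=
  if n is n.+1 then abs_poly n + 2^-1%:P * ('X ^+ 2 - abs_poly n ^+ 2) else 0.

(** The error e_n satisfies e_(n+1) = e_n (1 - (|t| + p_n(t)) / 2) <= e_n (1 - e_n / 2),
    whence the rate 2 / (n + 2), uniformly in t. *)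
Lemma abs_poly_bounds n (t : R) : `|t| <= 1 ->
  0 <= (abs_poly n).[t] /\ 0 <= `|t| - (abs_poly n).[t] <= 2 / n.+2%:R.
Proof.
move=> t1; elim: n => [|n [q0 /andP[e0 en]]].
  by rewrite horner0 subr0 normr_ge0 divff.
rewrite /= !hornerE -[t ^+ 2]real_normK ?num_real//.
move: (abs_poly n).[t] q0 e0 en => q q0 e0 en; have s0 := normr_ge0 t.
move: `|t| t1 s0 e0 en => s s1 s0 e0 en.
split; first by nra.
have -> : s - (q + 2^-1 * (s ^+ 2 - q ^+ 2)) = (s - q) * (1 - (s + q) / 2) by field.
rewrite mulr_ge0//=; last by lra.
apply: (@le_trans _ _ ((s - q) * (1 - (s - q) / 2))); first by rewrite ler_wpM2l//; lra.
move: (s - q) e0 en => e e0 en.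
have m0 : 2 <= n.+2%:R :> R by rewrite ler_nat.
rewrite -[n.+3%:R]natr1; move: (n.+2%:R) m0 en => m m2 en.
have m0 : 0 < m by lra.
have mi : 2 / m <= 1 by rewrite ler_pdivrMr ?mul1r.
apply: (@le_trans _ _ ((2 / m) * (1 - (2 / m) / 2))); first by nra.
rewrite -subr_ge0.
have -> : 2 / (m + 1) - 2 / m * (1 - 2 / m / 2) = 2 / (m ^+ 2 * (m + 1)).
  by field; rewrite !gt_eqF// ltr_wpDl// ltW.
by rewrite divr_ge0// mulr_ge0 ?sqr_ge0//; lra.
Qed.

Lemma negative_part_approx (K e : R) : 0 < K -> 0 < e -> exists p : {poly R},
  forall t, `|t| <= K -> `|p.[t] - Num.max 0 (- t)| <= e.
Proof.
move=> K0 e0; have d0 : 0 < e / K by rewrite divr_gt0.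
have [N hN] := inv_succ_lt d0.
exists (2^-1%:P * (K%:P * (abs_poly N \Po (K^-1%:P * 'X)) - 'X)) => t tK.
rewrite !hornerE horner_comp !hornerE.
have tK1 : `|K^-1 * t| <= 1.
  by rewrite normrM gtr0_norm ?invr_gt0// mulrC ler_pdivrMr// mul1r.
have [_ /andP[h0 h1]] := abs_poly_bounds N tK1.
have h2 : 2 / N.+2%:R <= 2 * (e / K).
  rewrite ler_wpM2l//; apply: le_trans (ltW (hN _ (leqnn N))).
  by rewrite lef_pV2 ?posrE// ler_nat.
have -> : Num.max 0 (- t) = 2^-1 * (K * `|K^-1 * t| - t).
  rewrite normrM gtr0_norm ?invr_gt0// mulrA mulfV ?gt_eqF// mul1r.
  have [ht|ht] := lerP 0 t.
    by rewrite max_l ?oppr_le0// ger0_norm// subrr mulr0.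
  by rewrite max_r ?oppr_ge0 ?(ltW ht)// ltr0_norm//; lra.
set q := (abs_poly N).[_] in h0 h1 *; set s := `|_ * t| in h0 h1 *.
have -> : 2^-1 * (K * q - t) - 2^-1 * (K * s - t) = - (2^-1 * (K * (s - q))) by field.
rewrite normrN ger0_norm ?mulr_ge0 ?(ltW K0) ?invr_ge0 ?ler0n//.
have := ler_wpM2l (ltW K0) (le_trans h1 h2).
rewrite (_ : K * (2 * (e / K)) = 2 * e); first by move: (K * (s - q)) => z zl; lra.
by field; rewrite gt_eqF.
Qed.

Variables (H : hilbertType R) (X : H -> H).
Hypotheses (bX : bounded_operator X) (sX : symmetric_operator X).

Let lX : linear X := proj1 bX.

(** By [poly_operator_le], polynomials that converge uniformly on the spectrum form a
    Cauchy sequence of operators. *)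
Lemma functional_calculus_exists (f : R -> R) :
  (forall e, 0 < e -> exists p : {poly R},
     forall t, spectrum (graph X) t%:C -> `|p.[t] - f t| <= e) ->
  exists Y, is_functional_calculus f X Y.
Proof.
move=> hf.
have /choice[p hp] n : exists p : {poly R},
    forall t, spectrum (graph X) t%:C -> `|p.[t] - f t| <= n.+1%:R^-1.
  by apply: hf; rewrite invr_gt0.
have pB m n x : hnorm (poly_operator (p m) X x - poly_operator (p n) X x) <=
    (m.+1%:R^-1 + n.+1%:R^-1) * hnorm x.
  rewrite -poly_operatorN// -poly_operatorD//; apply: poly_operator_le => // t st.
  rewrite hornerD hornerN.
  have -> : (p m).[t] - (p n).[t] = ((p m).[t] - f t) - ((p n).[t] - f t) by ring.
  by apply: le_trans (ler_normB _ _) _; rewrite lerD ?hp.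
have /choice[Y hY] x : exists l, forall e : R, 0 < e ->
    exists N, forall n, (N <= n)%N -> hnorm (l - poly_operator (p n) X x) < e.
  apply: hilbert_complete => e e0.
  have x1 : 0 < hnorm x + 1 by rewrite ltr_wpDl ?hnorm_ge0.
  have [|N hN] := @inv_succ_lt R (e / 2 / (hnorm x + 1)); first by rewrite !divr_gt0.
  exists N => m n Nm Nn; apply: le_lt_trans (pB _ _ _) _.
  have := hN _ Nm; have := hN _ Nn; rewrite !ltr_pdivlMr//.
  have := hnorm_ge0 x; have : 0 < m.+1%:R^-1 :> R by rewrite invr_gt0.
  have : 0 < n.+1%:R^-1 :> R by rewrite invr_gt0.
  by move: (m.+1%:R^-1) (n.+1%:R^-1) (hnorm x) => *; nra.
have YB n x : hnorm (Y x - poly_operator (p n) X x) <= 2 / n.+1%:R * hnorm x.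
  apply/ler_addgt0Pl => e e0; have [N hN] := hY x _ e0.
  apply: le_trans (hnorm_triangle _ (poly_operator (p (maxn N n)) X x) _) _.
  rewrite lerD//; first by rewrite ltW// hN// leq_maxl.
  apply: le_trans (pB _ _ _) _; rewrite ler_wpM2r ?hnorm_ge0//.
  by rewrite mulrDl mul1r lerD2r lef_pV2 ?posrE// ler_nat ltnS leq_maxr.
have YK (K : R) (x : H) : (forall n, hnorm x <= K * n.+1%:R^-1) -> x = 0.
  move=> h; apply: (@hnorm_small0 R H x `|K|) => e /inv_succ_lt[N hN].
  apply: le_trans (h N) _; apply: (@le_trans _ _ (`|K| * N.+1%:R^-1)).
    by rewrite ler_wpM2r ?invr_ge0// ler_norm.
  by rewrite ler_wpM2l// ltW// hN.
have lY : linear Y.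
  move=> k x y; apply/eqP; rewrite -subr_eq0; apply/eqP.
  apply: (YK (2 * (hnorm (k *: x + y) + complex.Re `|k| * hnorm x + hnorm y))) => n.
  pose P := poly_operator (p n) X.
  have -> : Y (k *: x + y) - (k *: Y x + Y y) = (Y (k *: x + y) - P (k *: x + y)) -
      (k *: (Y x - P x) + (Y y - P y)).
    rewrite scalerBr addrACA -opprD -(poly_operator_linear lX) -/P.
    by rewrite [RHS]subrACA subrr subr0.
  apply: le_trans (ler_hnormB _ _) _; apply: le_trans (lerD (lexx _) (ler_hnormD _ _)) _.
  rewrite hnormZ; have k0 : 0 <= complex.Re `|k| by rewrite -ler0c RRe_real ?normr_real.
  have := YB n (k *: x + y); have := ler_wpM2l k0 (YB n x); have := YB n y.
  rewrite -/P [2 / _]mulrC; move: (n.+1%:R^-1) (complex.Re _) => i c.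
  have -> : c * (i * 2 * hnorm x) = i * 2 * (c * hnorm x) by ring.
  by lra.
have bY : bounded_operator Y.
  have bp := poly_operator_bounded lX (p 0%N) bX.
  apply: (bounded_opP (K := 2 + opnorm (poly_operator (p 0%N) X)) lY) => x.
  rewrite -[Y x](subrK (poly_operator (p 0%N) X x)) mulrDl.
  apply: le_trans (ler_hnormD _ _) _; rewrite lerD ?opnormP//.
  by have := YB 0%N x; rewrite divr1.
exists Y; split => //; exists p; split.
  move=> P /uniform_nbhs[E [entE subP]].
  have [e /= e0 eE] : exists2 e : R, 0 < e & forall a b : R, `|a - b| < e -> E (a, b).
    move: entE; rewrite -entourage_ballE => -[e /= e0 eE]; exists e => // a b ab.
    by apply: (eE (a, b)); rewrite /= -ball_normE.
  have [N hN] := inv_succ_lt e0.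
  exists N => // n /= Nn; apply: subP => t st; apply: eE.
  by rewrite distrC; apply: le_lt_trans (hp _ _ st) (hN _ Nn).
apply: (@squeeze_cvgr nat \oo _ R (fun=> 0) (fun n => 2 * n.+1%:R^-1)).
- apply: nearW => n; have bq : bounded_operator (poly_operator (p n) X \- Y).
    by apply: bounded_sub => //; exact: poly_operator_bounded.
  rewrite opnorm_ge0//=.
  apply: opnorm_le => [|x]; first by rewrite mulr_ge0 ?invr_ge0.
  by rewrite /= hdistC YB.
- exact: cvg_cst.
- have := cvgM (cvg_cst (2 : R)) (@cvg_harmonic R); rewrite mulr0; exact.
Qed.

(** The spectrum is bounded, so it is enough to approximate on an interval. *)
Lemma negative_part_calculus :
  is_functional_calculus (fun t => Num.max 0 (- t)) X (negative_part X).
Proof.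
rewrite /negative_part /functional_calculus; apply: xgetPex.
apply: functional_calculus_exists => e e0.
have K0 : 0 < opnorm X + 1 by rewrite ltr_wpDl ?opnorm_ge0.
have [p hp] := negative_part_approx K0 e0; exists p => t st; apply: hp.
apply: le_trans (_ : opnorm X <= _); last by rewrite lerDl.
by apply: spectrum_le_norm st => // x; exact: opnormP.
Qed.

(** On the spectrum t + t^- >= 0, so X + p_n(X) has almost nonnegative form when p_n
    is close to t^-, and p_n(X) is close to X^-. *)
Lemma negative_part_form_ge x :
  - (opnorm (negative_part X) * hnorm x ^+ 2) <= rdot (X x) x.
Proof.
have [bY [p [up op]]] := negative_part_calculus.
set Y := negative_part X in bY op *.
apply/ler_addgt0Pl => e e0.
have d0 : 0 < e / (2 * (hnorm x ^+ 2 + 1)).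
  by rewrite divr_gt0// mulr_gt0// ltr_wpDl ?sqr_ge0.
set d := e / _ in d0.
have [n [hu ho]] : exists n, (forall t, spectrum (graph X) t%:C ->
    `|(p n).[t] - Num.max 0 (- t)| < d) /\ opnorm (poly_operator (p n) X \- Y) < d.
  have N1 : \forall n \near \oo, forall t, spectrum (graph X) t%:C ->
      `|(p n).[t] - Num.max 0 (- t)| < d.
    apply: (up [set h : R -> R |
      forall t, spectrum (graph X) t%:C -> `|h t - Num.max 0 (- t)| < d]).
    apply/uniform_nbhs; exists [set xy : R * R | (`|xy.1 - xy.2| < d)%R]; split => /=.
      by rewrite -entourage_ballE; exists d.
    by move=> h /= hh t st; rewrite distrC; exact: hh.
  have N2 : \forall n \near \oo, opnorm (poly_operator (p n) X \- Y) < d.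
    move/cvgrPdist_lt : op => /(_ _ d0); apply: filterS => n; rewrite sub0r normrN.
    by apply: le_lt_trans; exact: ler_norm.
  by have [n []] := filter_ex (filterI N1 N2); exists n.
have bP : bounded_operator (poly_operator (p n) X) by exact: poly_operator_bounded.
have h1 : - d * hnorm x ^+ 2 <= rdot (poly_operator ('X + p n) X x) x.
  apply: poly_operator_ge => // t st; rewrite hornerD hornerX.
  have := hu _ st; rewrite ltr_norml => /andP[lo _].
  have : - t <= Num.max 0 (- t) by rewrite le_max lexx orbT.
  by move: (Num.max _ _) lo => *; lra.
rewrite poly_operatorD// poly_operatorX// rdotDl in h1.
have h2 : rdot (poly_operator (p n) X x) x <= (opnorm Y + d) * hnorm x ^+ 2.
  rewrite -[poly_operator _ _ x](subrK (Y x)) rdotDl mulrDl addrC expr2 !mulrA.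
  apply: lerD; apply: le_trans (ler_rdot _ _) _; rewrite ler_wpM2r ?hnorm_ge0 ?opnormP//.
  by apply: le_trans (opnormP x (bounded_sub bP bY)) _; rewrite ler_wpM2r ?hnorm_ge0 ?(ltW ho).
have h3 : 2 * d * hnorm x ^+ 2 <= e.
  have s1 : 0 < hnorm x ^+ 2 + 1 by rewrite ltr_wpDl ?sqr_ge0.
  rewrite (_ : 2 * d * _ = e * (hnorm x ^+ 2 / (hnorm x ^+ 2 + 1))); last first.
    by rewrite /d; field; rewrite gt_eqF.
  by rewrite ler_piMr ?(ltW e0)// ler_pdivrMr// mul1r lerDl.
by move: (rdot _ _) (rdot _ _) h1 h2 => *; lra.
Qed.
End NegativePart.

(** * Numerical series *)

Section Sums.
Variable R : realType.
Implicit Types f : nat -> R.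

Lemma finite_eseries_bounded m f : (forall n, 0 <= f n) ->
  (\sum_(m <= n <oo) (f n)%:E < +oo)%E ->
  exists K, forall n, \sum_(m <= k < n) f k <= K.
Proof.
move=> f0 fin; exists (fine (\sum_(m <= n <oo) (f n)%:E)%E) => n.
have fnum : (\sum_(m <= n <oo) (f n)%:E)%E \is a fin_num.
  by rewrite ge0_fin_numE// nneseries_ge0// => k _ _; rewrite lee_fin.
rewrite -lee_fin fineK// -sumEFin; apply: nneseries_lim_ge => k _ _.
by rewrite lee_fin.
Qed.

Lemma infinite_eseries_unbounded f : (forall n, 0 <= f n) ->
  (\sum_(0 <= n <oo) (f n)%:E = +oo)%E ->
  forall N K, exists n, K <= \sum_(N <= k < n) f k.
Proof.
move=> f0 inf N K; apply: contrapT => /forallNP h.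
have : (\sum_(0 <= n <oo) (f n)%:E <= (\sum_(0 <= k < N) f k + `|K|)%:E)%E.
  apply: lime_le; first by apply: is_cvg_nneseries => n _ _; rewrite lee_fin.
  apply: nearW => n; rewrite sumEFin lee_fin.
  have [nN|/ltnW Nn] := leqP n N.
    rewrite (@big_cat_nat _ _ _ n _ N)//= -addrA lerDl addr_ge0//.
    by apply: sumr_ge0.
  rewrite (@big_cat_nat _ _ _ N _ n)//= lerD2l.
  have /negP := h n; rewrite -ltNge => /ltW /le_trans; apply; exact: ler_norm.
by rewrite inf.
Qed.

Lemma bounded_sums_tail m f (K : R) : (forall n, 0 <= f n) ->
  (forall n, \sum_(m <= k < n) f k <= K) ->
  forall e, 0 < e -> exists2 N, (m <= N)%N & forall n, \sum_(N <= k < n) f k <= e.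
Proof.
move=> f0 fK e e0; pose D := [set \sum_(m <= k < n) f k | n in [set: nat]].
have D0 : D !=set0 by exists (\sum_(m <= k < 0) f k), 0%N.
have uD : has_ubound D by exists K => _ [n _ <-].
have [_ [N _ <-] lt] := sup_adherent e0 (conj D0 uD).
have SN n : (n <= N)%N -> \sum_(m <= k < n) f k <= \sum_(m <= k < N) f k.
  move=> nN; have [mn|/ltnW nm] := leqP m n.
    by rewrite [leRHS](@big_cat_nat _ _ _ n)//= lerDl sumr_ge0.
  by rewrite big_geq// sumr_ge0.
exists (maxn m N) => [|n]; first exact: leq_maxl.
have [nN|/ltnW Nn] := leqP n (maxn m N); first by rewrite big_geq// ltW.
have : \sum_(m <= k < n) f k <= sup D by apply: ub_le_sup => //; exists n.
rewrite (@big_cat_nat _ _ _ (maxn m N))//=; last exact: leq_maxl.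
have : \sum_(m <= k < N) f k <= \sum_(m <= k < maxn m N) f k.
  have [mN|/ltnW Nm] := leqP m N; first by [].
  by rewrite big_geq// sumr_ge0.
move: (\sum_(m <= k < maxn m N) f k) (\sum_(m <= k < N) f k) (sup D) lt => *; lra.
Qed.

Lemma Re_sum (F : nat -> R[i]) n :
  complex.Re (\sum_(0 <= k < n) F k) = \sum_(0 <= k < n) complex.Re (F k).
Proof.
elim: n => [|n IH]; first by rewrite !big_geq.
by rewrite !big_nat_recr//= -IH; case: (\sum_(_ <= _ < _) _) (F n) => [? ?] [].
Qed.

Lemma Im_sum (F : nat -> R[i]) n :
  complex.Im (\sum_(0 <= k < n) F k) = \sum_(0 <= k < n) complex.Im (F k).
Proof.
elim: n => [|n IH]; first by rewrite !big_geq.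
by rewrite !big_nat_recr//= -IH; case: (\sum_(_ <= _ < _) _) (F n) => [? ?] [].
Qed.

Lemma lim_series_fin f n : (forall k, (n <= k)%N -> f k = 0) ->
  limn (series f) = \sum_(0 <= k < n) f k.
Proof.
move=> f0; apply: lim_near_cst => //; exists n => // k /= nk.
rewrite /series /= (@big_cat_nat _ _ _ n)//= [X in _ + X]big1_seq ?addr0// => i.
by rewrite mem_index_iota => /andP[_ /andP[/f0]].
Qed.

Lemma csum_fin (F : nat -> R[i]) n : (forall k, (n <= k)%N -> F k = 0) ->
  csum F = \sum_(0 <= k < n) F k.
Proof.
move=> F0; apply/eqP; rewrite eq_complex /csum /= Re_sum Im_sum.
by rewrite !(@lim_series_fin _ n) ?eqxx// => k /F0 ->.
Qed.

End Sums.

(** * Square-summable sequences and closures of graphs *)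

Section L2.
Variables (R : realType) (H : hilbertType R).
Implicit Types (u v : l2 H) (w : nat -> H).

Lemma l2_inner_finl u v n : (forall k, (n <= k)%N -> val u k = 0) ->
  inner u v = \sum_(0 <= k < n) inner (val u k) (val v k).
Proof. by move=> u0; apply: csum_fin => k /u0 ->; rewrite linear0l. Qed.

Lemma fin_l2 w n : (forall k, (n <= k)%N -> w k = 0) -> exists u, val u = w.
Proof.
move=> w0; pose S := \sum_(0 <= k < n) hnorm (w k) ^+ 2.
have S0 : 0 <= S by apply: sumr_ge0 => k _; exact: sqr_ge0.
have [||u [uw _]] := @l2_bounded_series _ _ w (S + 1); [by rewrite addr_ge0| |by exists u].
move=> m; apply: (@le_trans _ _ S); last by nra.
rewrite /S; have [mn|/ltnW nm] := leqP m n.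
  by rewrite (@big_cat_nat _ _ _ m _ n)//= lerDl sumr_ge0// => k _; exact: sqr_ge0.
rewrite (@big_cat_nat _ _ _ n _ m)//= [X in _ + X]big1_seq ?addr0// => i.
by rewrite mem_index_iota => /andP[_ /andP[/w0 -> _]]; rewrite hnorm0 expr0n.
Qed.

Lemma l2_near u w (M : R) : 0 <= M ->
  (forall n, \sum_(0 <= k < n) hnorm (val u k - w k) ^+ 2 <= M ^+ 2) ->
  exists2 u' : l2 H, val u' = w & hnorm (u - u') <= M.
Proof.
move=> M0 /(l2_bounded_series M0)[d [dE dM]]; exists (u - d).
  by apply/funext => k; rewrite /= dE /= subKr.
by rewrite subKr.
Qed.

Lemma l2_tail u (e : R) : 0 < e ->
  exists N, forall n, \sum_(N <= k < n) hnorm (val u k) ^+ 2 <= e.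
Proof.
move=> e0; have [||N _ hN] := @bounded_sums_tail R 0 (fun k => hnorm (val u k) ^+ 2)
  (hnorm u ^+ 2) _ _ e e0.
- by move=> n; exact: sqr_ge0.
- exact: hnorm_l2_series_le.
by exists N.
Qed.

Lemma l2_nbhsP (K : hilbertType R) (A : set (K * K)) (p : K * K) :
  nbhs p A <-> exists2 e : R, 0 < e &
    forall q, hnorm (p.1 - q.1) < e -> hnorm (p.2 - q.2) < e -> A q.
Proof.
split=> [/nbhs_ballP[e0 /= e00 h]|[e e0 h]].
  have /complex_realP[e eE] : e0 \is Num.real by exact: gtr0_real.
  move: e00 h; rewrite eE (ltcR 0) => e1 h; exists e => // q q1 q2; apply: h.
  by split; rewrite -ball_normE /ball_/= -hnormE ltcR.
apply/nbhs_ballP; exists e%:C => /=; first by rewrite (ltcR 0).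
move=> q [/=]; rewrite -!ball_normE /ball_/= -!hnormE !ltcR; exact: h.
Qed.

Lemma closure_graphP (K : hilbertType R) (A : set (K * K)) (p : K * K) :
  closure A p <-> forall e : R, 0 < e ->
    exists q, [/\ A q, hnorm (p.1 - q.1) < e & hnorm (p.2 - q.2) < e].
Proof.
split=> [cp e e0|h B /l2_nbhsP[e e0 hB]].
  pose B := [set q : K * K | hnorm (p.1 - q.1) < e /\ hnorm (p.2 - q.2) < e].
  have : nbhs p B by apply/l2_nbhsP; exists e.
  by move=> /cp[q [Aq [q1 q2]]]; exists q.
by have [q [Aq q1 q2]] := h e e0; exists q; split => //; exact: hB.
Qed.

Lemma closure_sub_adjoint (K : hilbertType R) (A T : set (K * K)) :
  A `<=` adjoint_graph T -> closure A `<=` adjoint_graph T.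
Proof.
move=> AT [u v] /closure_graphP cp; apply: adjoint_graph_closed => e /cp[[u' v'] [A' h1 h2]].
by exists u', v'; split => //; exact: AT.
Qed.

(** Membership of p in the adjoint is itself a closed condition on the graph: it says
    that the graph is contained in the adjoint of {p}. *)
Lemma adjoint_graph_closure (K : hilbertType R) (A : set (K * K)) :
  adjoint_graph (closure A) = adjoint_graph A.
Proof.
apply/seteqP; split=> p hp.
  by move=> u v Auv; apply: hp; exact: subset_closure.
have sw (f g u v : K) : adjoint_graph [set (f, g)] (u, v) <-> inner v f = inner u g.
  split=> [h|e f' g' [-> ->] /=].
    have /= e := h f g erefl; rewrite [LHS]hermC [RHS]hermC; congr (_ * Num.conj _).
    exact: esym e.
  by rewrite [LHS]hermC [RHS]hermC; congr (_ * Num.conj _); exact: esym e.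
case: p hp => f g hp.
have : A `<=` adjoint_graph [set (f, g)] by move=> [u v] Auv; apply/sw; exact: hp.
by move=> /closure_sub_adjoint h u v /h /sw.
Qed.

End L2.


(** * Green's identity and the adjoint of the minimal Jacobi matrix *)

Section Jacobi.
Variables (R : realType) (H : hilbertType R) (a b : nat -> H -> H).
Hypotheses (ba : forall n, bounded_operator (a n))
  (bb : forall n, bounded_operator (b n))
  (sb : forall n, adjoint (b n) = b n).
Implicit Types (f u : nat -> H).

Let la n : linear (a n) := proj1 (ba n).
Let lb n : linear (b n) := proj1 (bb n).
Let las n : linear (adjoint (a n)) := adjoint_linear (ba n).

Notation J := (formal_jacobi a b).

(** Summation by parts: the boundary terms at n are kept on the side where they have
    a plus sign. *)
Lemma green_identity f u n :
  \sum_(0 <= k < n.+1) inner (J f k) (u k) +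
    inner (f n) (a n (u n.+1)) =
  \sum_(0 <= k < n.+1) inner (f k) (J u k) + inner (a n (f n.+1)) (u n).
Proof.
have sbn k x y : inner (b k x) y = inner x (b k y) by rewrite adjointP// sb.
elim: n => [|n IH].
  by rewrite !big_nat1 /= linearDl linearDr /= sbn addrAC.
rewrite big_nat_recr//= [in RHS]big_nat_recr//=.
rewrite !linearDl !linearDr /= sbn -(adjointPr (f n)) //.
have {}IH := congr1 (fun z => z + inner (f n.+1) (adjoint (a n) (u n)) +
  inner (f n.+1) (b n.+1 (u n.+1)) + inner (a n.+1 (f n.+2)) (u n.+1) +
  inner (f n.+1) (a n.+1 (u n.+2)) - inner (a n (f n.+1)) (u n)) IH.
rewrite (adjointP (f n.+1) (u n))// in IH *.
apply: etrans (etrans IH _); ring.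
Qed.

Lemma formal_jacobi_fin f n : (forall k, (n <= k)%N -> f k = 0) ->
  forall k, (n.+1 <= k)%N -> J f k = 0.
Proof.
move=> f0 [//|k] /=; rewrite ltnS => nk.
rewrite (f0 _ nk) (f0 _ (leqW nk)) (f0 _ (leqW (leqW nk))).
by rewrite (linear_op0 (las _)) (linear_op0 (lb _)) (linear_op0 (la _)) !addr0.
Qed.

Lemma green_fin f u n : (forall k, (n <= k)%N -> f k = 0) ->
  \sum_(0 <= k < n.+1) inner (J f k) (u k) = \sum_(0 <= k < n.+1) inner (f k) (J u k).
Proof.
move=> f0; have := green_identity f u n.
by rewrite !f0 ?leqnSn// (linear_op0 (la n)) !linear0l !addr0.
Qed.

Lemma minimal_jacobiP p : minimal_jacobi a b p <->
  val p.2 = J (val p.1) /\ exists n, forall k, (n <= k)%N -> val p.1 k = 0.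
Proof.
split=> [[/finite_seqP[s sE] ->]|[pE [n hn]]].
  split=> //; exists (\max_(i <- s) i).+1 => k sk; apply/eqP/negP => /negP kn.
  have : k \in s by have : [set` s] k by rewrite -sE.
  by move=> ks; have := @leq_bigmax_seq _ s xpredT id k ks isT; rewrite leqNgt sk.
split=> //; apply: (@sub_finite_set _ _ `I_n); last exact: finite_II.
by move=> k /=; apply: contraNT; rewrite -leqNgt => /hn ->.
Qed.

Lemma minimal_of_fin (w : nat -> H) n : (forall k, (n <= k)%N -> w k = 0) ->
  exists p : l2 H * l2 H, [/\ minimal_jacobi a b p, val p.1 = w & val p.2 = J w].
Proof.
move=> w0; have [u uE] := fin_l2 w0; have [v vE] := fin_l2 (formal_jacobi_fin w0).
exists (u, v); split=> //; apply/minimal_jacobiP => /=.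
by rewrite uE vE; split => //; exists n.
Qed.

(** Testing with the sequences carried by a single index n gives the n-th row. *)
Lemma adjoint_minimal_jacobi :
  adjoint_graph (minimal_jacobi a b) = [set p | val p.2 = J (val p.1)].
Proof.
have key (f g u : l2 H) n : val g = J (val f) -> (forall k, (n <= k)%N -> val f k = 0) ->
    inner g u = \sum_(0 <= k < n.+1) inner (val f k) (J (val u) k).
  move=> gE f0; rewrite (@l2_inner_finl _ _ g u n.+1); last first.
    by move=> k nk; rewrite gE (formal_jacobi_fin f0).
  by rewrite gE green_fin.
apply/seteqP; split=> -[u v] /= h.
  apply/funext => n; apply: inner_inj => x.
  pose d k := if k == n then x else 0.
  have d0 k : (n.+1 <= k)%N -> d k = 0 by rewrite /d; case: eqP => // ->; rewrite ltnn.
  have [[f g] [Tfg fE0 gE0]] := minimal_of_fin d0.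
  have fE : val f = d := fE0.
  have gE : val g = J (val f) := etrans gE0 (congr1 J (esym fE0)).
  have f0 : forall k, (n.+1 <= k)%N -> val f k = 0 by move=> k /d0; rewrite -fE.
  have sumd (y : nat -> H) m : (n < m)%N ->
      \sum_(0 <= k < m) inner (d k) (y k) = inner x (y n).
    move=> nm; rewrite (bigD1_seq n) ?mem_index_iota ?iota_uniq//=.
    rewrite /d eqxx big1 ?addr0// => k /negbTE ->; exact: linear0l.
  have : inner g u = inner f v := h _ _ Tfg.
  rewrite (key f g u n.+1 gE f0) (@l2_inner_finl _ _ f v n.+1 f0) fE.
  by rewrite (sumd (J (val u)))// (sumd (val v))// => ->.
move=> f g /minimal_jacobiP /= [gE [n hn]].
have hE : val v = J (val u) := h.
rewrite (key f g u n)// (@l2_inner_finl _ _ f v n.+1) ?hE//.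
by move=> k nk; apply: hn; exact: ltnW.
Qed.

End Jacobi.

(** * Carleman's condition and self-adjointness *)

Lemma subrDDD (V : zmodType) (p q r p' r' : V) :
  (p + q + r) - (p' + q + r') = (p - p') + (r - r').
Proof. by rewrite !opprD addrACA; congr (_ + _); rewrite addrACA subrr addr0. Qed.

Lemma subrDD_l (V : zmodType) (p q r : V) : (p + q) - (p + r) = q - r.
Proof. by rewrite opprD addrACA subrr add0r. Qed.

Section Carleman.
Variables (R : realType) (H : hilbertType R) (a b : nat -> H -> H).
Hypotheses (ba : forall n, bounded_operator (a n))
  (bb : forall n, bounded_operator (b n))
  (sb : forall n, adjoint (b n) = b n).
Implicit Types (u : nat -> H).

Let la n : linear (a n) := proj1 (ba n).
Let lb n : linear (b n) := proj1 (bb n).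
Let las n : linear (adjoint (a n)) := adjoint_linear (ba n).

Notation J := (formal_jacobi a b).

Definition cutoff N k : R := Num.max 0 (1 - \sum_(N <= j < k) (opnorm (a j))^-1).

Lemma cutoff1 N k : (k <= N)%N -> cutoff N k = 1.
Proof. by move=> kN; rewrite /cutoff big_geq// subr0 max_r. Qed.

Lemma cutoff_bounds N k : 0 <= cutoff N k <= 1.
Proof.
rewrite /cutoff le_max lexx /= ge_max ler01 /= gerBl.
by apply: sumr_ge0 => j _; rewrite invr_ge0 opnorm_ge0.
Qed.

(** The product is 0 rather than 1 when ||a_k|| = 0, the inverse of 0 being 0. *)
Lemma cutoff_step N k : `|cutoff N k.+1 - cutoff N k| * opnorm (a k) <= (N <= k)%:R.
Proof.
have [Nk|kN] := leqP N k; last by rewrite !cutoff1 ?(ltnW kN)// subrr normr0 mul0r.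
have o0 := opnorm_ge0 (ba k).
have [->|on] := eqVneq (opnorm (a k)) 0; first by rewrite mulr0.
have op : 0 < opnorm (a k) by rewrite lt_neqAle eq_sym on.
rewrite -ler_pdivlMr// mul1r /cutoff big_nat_recr//=.
have : 0 <= (opnorm (a k))^-1 by rewrite invr_ge0.
move: (opnorm _)^-1 (\sum_(_ <= _ < _) _) => i s i0.
have [h1|h1] := lerP 0 (1 - s); have [h2|h2] := lerP 0 (1 - (s + i));
  by rewrite ler_norml; lra.
Qed.

(** The diagonal terms commute with the cutoff.  In row 0, where k.-1 = 0, the first
    summand on the right is a spare nonnegative term. *)
Lemma cutoff_commutator N u k :
  hnorm (J (fun k => (cutoff N k)%:C *: u k) k - (cutoff N k)%:C *: J u k) <=
  (N <= k.-1)%:R * hnorm (u k.-1) + (N <= k)%:R * hnorm (u k.+1).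
Proof.
have step j x (Y : H -> H) (c : R) : linear Y ->
    (forall x, hnorm (Y x) <= opnorm (a j) * hnorm x) ->
    `|c| = `|cutoff N j.+1 - cutoff N j| -> hnorm (c%:C *: Y x) <= (N <= j)%:R * hnorm x.
  move=> lY hY hc; rewrite hnormZr hc.
  apply: le_trans (ler_wpM2r (hnorm_ge0 x) (cutoff_step N j)); rewrite -mulrA.
  by rewrite ler_wpM2l.
have n1 j x : hnorm (a j x) <= opnorm (a j) * hnorm x by exact: opnormP.
have n2 j x : hnorm (adjoint (a j) x) <= opnorm (a j) * hnorm x by exact: adjoint_le.
case: k => [|k] /=.
  rewrite (linear_opZ _ _ (lb _)) (linear_opZ _ _ (la _)) scalerDr subrDD_l -scalerBl -rmorphB.
  apply: le_trans (step 0%N _ (a 0%N) _ _ _ erefl) _ => //.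
  by rewrite lerDr mulr_ge0 ?hnorm_ge0.
rewrite (linear_opZ _ _ (lb _)) (linear_opZ _ _ (la _)) (linear_opZ _ _ (las _)) !scalerDr.
rewrite subrDDD -!scalerBl -!rmorphB.
apply: le_trans (ler_hnormD _ _) _; apply: lerD.
  by apply: step => //; rewrite distrC.
exact: step.
Qed.

Lemma shifted_sums (t : nat -> R) (d : R) : (forall k, 0 <= t k) ->
  (forall n, \sum_(0 <= k < n) t k <= d) ->
  forall n, \sum_(0 <= k < n) t k.-1 <= 2 * d /\ \sum_(0 <= k < n) t k.+1 <= d.
Proof.
move=> t0 ht n; split.
  have d0 : 0 <= d by have := ht 0%N; rewrite big_geq.
  case: n => [|n]; first by rewrite big_geq// mulr_ge0.
  rewrite big_nat_recl//= mulrDl mul1r lerD ?ht//.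
  by have := ht 1%N; rewrite big_nat1.
apply: le_trans (ht n.+1); rewrite big_nat_recl//= lerDr //.
Qed.

Hypothesis carleman : forall N (K : R), exists n, K <= \sum_(N <= k < n) (opnorm (a k))^-1.

Lemma cutoff_fin N : exists n, forall k, (n <= k)%N -> cutoff N k = 0.
Proof.
have [n hn] := carleman N 1; exists n => k nk; rewrite /cutoff max_l// subr_le0.
apply: le_trans hn _; have [Nn|/ltnW nN] := leqP N n.
  rewrite [leRHS](@big_cat_nat _ _ _ n)//= lerDl sumr_ge0// => j _.
  by rewrite invr_ge0 opnorm_ge0.
by rewrite big_geq// sumr_ge0// => j _; rewrite invr_ge0 opnorm_ge0.
Qed.

Lemma tail_sum_le (s : nat -> R) (d : R) N : (forall k, 0 <= s k) -> 0 <= d ->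
  (forall n, \sum_(N <= k < n) s k <= d) ->
  forall n, \sum_(0 <= k < n) (N <= k)%:R * s k <= d.
Proof.
move=> s0 d0 h n; have [nN|/ltnW Nn] := leqP n N.
  rewrite big1_seq// => k; rewrite mem_index_iota => /andP[_ /andP[_ kn]].
  by rewrite leqNgt (leq_trans kn nN) mul0r.
rewrite (@big_cat_nat _ _ _ N)//= big1_seq ?add0r => [|k].
  apply: le_trans (h n); rewrite le_eqVlt; apply/orP; left; apply/eqP.
  by apply: eq_big_nat => k /andP[-> _]; rewrite mul1r.
by rewrite mem_index_iota => /andP[_ /andP[_ kN]]; rewrite leqNgt kN mul0r.
Qed.

(** The error in v has three parts, each bounded by a tail: the truncation of v and
    the two off-diagonal terms of the commutator.  The tail of u shifted by .-1 counts
    the index 0 twice, so the squares sum up to 3 (1 + 2 + 1) d^2 <= (4 d)^2. *)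
Lemma maximal_sub_closure (p : l2 H * l2 H) : val p.2 = J (val p.1) ->
  closure (minimal_jacobi a b) p.
Proof.
case: p => u v vE0; have vE : val v = J (val u) := vE0.
apply/closure_graphP => e e0.
pose d := e / 5; have d0 : 0 < d by rewrite divr_gt0.
have dd : 0 < d ^+ 2 by rewrite exprn_gt0.
have [N1 hN1] := l2_tail u dd; have [N2 hN2] := l2_tail v dd.
pose N := maxn N1 N2.
have tailW (w : l2 H) M : (forall n, \sum_(M <= k < n) hnorm (val w k) ^+ 2 <= d ^+ 2) ->
    (M <= N)%N -> forall n, \sum_(N <= k < n) hnorm (val w k) ^+ 2 <= d ^+ 2.
  move=> h MN n; have [nN|/ltnW Nn] := leqP n N; first by rewrite big_geq// ltW.
  apply: le_trans (h n); rewrite [leRHS](@big_cat_nat _ _ _ N)//= lerDr.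
  by rewrite sumr_ge0// => k _; exact: sqr_ge0.
have sq0 (w : l2 H) k : 0 <= hnorm (val w k) ^+ 2 by exact: sqr_ge0.
have tu := tail_sum_le (sq0 u) (ltW dd) (tailW _ _ hN1 (leq_maxl _ _)).
have tv := tail_sum_le (sq0 v) (ltW dd) (tailW _ _ hN2 (leq_maxr _ _)).
pose w k := (cutoff N k)%:C *: val u k.
have cut (y : H) k : hnorm (y - (cutoff N k)%:C *: y) <= (N <= k)%:R * hnorm y.
  rewrite -{1}[y]scale1r -scalerBl -[1 in X in X - _]/(1%:C) -rmorphB hnormZr.
  rewrite ler_wpM2r ?hnorm_ge0//; have /andP[c0 c1] := cutoff_bounds N k.
  have [Nk|kN] := leqP N k; first by rewrite ger0_norm ?subr_ge0// lerBlDr lerDl.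
  by rewrite cutoff1 ?(ltnW kN)// subrr normr0.
have sqb k (y : R) : ((N <= k)%:R * y) ^+ 2 = (N <= k)%:R * y ^+ 2.
  by case: (N <= k)%N; rewrite ?mul1r ?mul0r ?expr0n.
have [u' u'E u'n] : exists2 u' : l2 H, val u' = w & hnorm (u - u') <= d.
  apply: l2_near; first exact: ltW.
  move=> n; apply: le_trans (tu n); apply: ler_sum => k _.
  by rewrite -sqb ler_sqr ?nnegrE ?hnorm_ge0 ?mulr_ge0 ?hnorm_ge0// cut.
have [v' v'E v'n] : exists2 v' : l2 H, val v' = J w & hnorm (v - v') <= 4 * d.
  apply: l2_near; first by rewrite mulr_ge0// ltW.
  move=> n.
  have [s1 s2] := @shifted_sums (fun k => (N <= k)%:R * hnorm (val u k) ^+ 2) _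
    (fun k => mulr_ge0 (ler0n _ _) (sq0 u k)) tu n.
  have s3 := tv n.
  pose T := \sum_(0 <= k < n) (3 * ((N <= k)%:R * hnorm (val v k) ^+ 2) +
     (3 * ((N <= k.-1)%:R * hnorm (val u k.-1) ^+ 2) +
      3 * ((N <= k.+1)%:R * hnorm (val u k.+1) ^+ 2))).
  apply: (@le_trans _ _ T); last first.
    rewrite /T !big_split /= -!mulr_sumr; move: s1 s2 s3 dd.
    by rewrite (_ : (4 * d) ^+ 2 = 16 * d ^+ 2); [lra|ring].
  apply: ler_sum => k _; rewrite -!sqb.
  have h1 := cutoff_commutator N (val u) k; have h2 := cut (val v k) k.
  have h3 : hnorm (val v k - J w k) <= (N <= k)%:R * hnorm (val v k) +
      ((N <= k.-1)%:R * hnorm (val u k.-1) + (N <= k.+1)%:R * hnorm (val u k.+1)).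
    apply: le_trans (hnorm_triangle _ ((cutoff N k)%:C *: val v k) _) _; apply: lerD => //.
    rewrite hdistC {1}vE; apply: le_trans h1 _; rewrite lerD2l ler_wpM2r ?hnorm_ge0// ler_nat.
    by case: (leqP N k) => // /leqW ->.
  move: h3 (hnorm_ge0 (val v k - J w k)).
  move: (hnorm (val v k - J w k)) (_ * hnorm _) (_ * hnorm _) (_ * hnorm _) => x p q r h x0.
  apply: (@le_trans _ _ ((r + (q + p)) ^+ 2)).
    by rewrite ler_sqr ?nnegrE// (le_trans x0 h).
  have := sqr_ge0 (p - q); have := sqr_ge0 (p - r); have := sqr_ge0 (q - r).
  by nra.
have e5 : e = 5 * d by rewrite /d; field.
exists (u', v'); split => /=.
- apply/minimal_jacobiP => //; split; first by rewrite -[LHS]/(val v') v'E -u'E.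
  have [n hn] := cutoff_fin N; exists n => k nk.
  by rewrite -[LHS]/(val u' k) u'E /w hn// scale0r.
- by apply: le_lt_trans u'n _; rewrite e5; lra.
- by apply: le_lt_trans v'n _; rewrite e5; lra.
Qed.

Lemma block_jacobiE : block_jacobi a b = [set p | val p.2 = J (val p.1)].
Proof.
apply/seteqP; split=> p; last exact: maximal_sub_closure.
rewrite -(adjoint_minimal_jacobi ba bb sb);
apply: closure_sub_adjoint => q /minimal_jacobiP[] // qE _.
by rewrite adjoint_minimal_jacobi.
Qed.

Lemma block_jacobi_adjoint : block_jacobi a b = adjoint_graph (block_jacobi a b).
Proof.
by rewrite {2}/block_jacobi adjoint_graph_closure adjoint_minimal_jacobi// block_jacobiE.
Qed.

Lemma block_jacobi_selfadjoint : selfadjoint (block_jacobi a b).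
Proof.
split; last exact: block_jacobi_adjoint.
move=> O [u Ou] oO.
have : nbhs u O by apply: open_nbhs_nbhs.
move=> /nbhs_ballP[e0 /= e00 h].
have /complex_realP[e eE] : e0 \is Num.real by exact: gtr0_real.
move: e00 h; rewrite eE (ltcR 0) => e1 h.
have d0 : 0 < e / 2 by rewrite divr_gt0.
have dd : 0 < (e / 2) ^+ 2 by rewrite exprn_gt0.
have [N hN] := l2_tail u dd.
pose w k := if (k < N)%N then val u k else 0.
have [||u' u'E u'n] := @l2_near _ _ u w (e / 2); first exact: ltW.
  move=> n; apply: le_trans (tail_sum_le (fun k => sqr_ge0 (hnorm (val u k))) (ltW dd) hN n).
  apply: ler_sum => k _; rewrite /w; case: leqP => kN.
    by rewrite subr0 mul1r.
  by rewrite subrr hnorm0 expr0n mul0r.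
have w0 k : (N <= k)%N -> w k = 0 by rewrite /w leqNgt => /negbTE ->.
have [[f g] [Tfg fE _]] := minimal_of_fin ba bb w0.
have fu : f = u' by apply: val_inj; rewrite u'E.
exists u'; split; last first.
  by exists g; apply: subset_closure; rewrite -fu.
apply: h; rewrite -ball_normE /ball_/= -hnormE ltcR.
by apply: le_lt_trans u'n _; rewrite ltr_pdivrMr// ltr_pMr// ltr1n.
Qed.
End Carleman.

(** * The energy of a solution of the recurrence *)

Section Energy.
Variables (R : realType) (H : hilbertType R) (a b : nat -> H -> H).
Hypotheses (ba : forall n, bounded_operator (a n))
  (bb : forall n, bounded_operator (b n))
  (sb : forall n, adjoint (b n) = b n).

Let la n : linear (a n) := proj1 (ba n).
Let lb n : linear (b n) := proj1 (bb n).
Let las n : linear (adjoint (a n)) := adjoint_linear (ba n).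

Variables (l : R) (u : nat -> H).
Hypothesis recurrence : forall n,
  adjoint (a n) (u n) + b n.+1 (u n.+1) + a n.+1 (u n.+2) = l%:C *: u n.+1.

Definition energy n : R :=
  hnorm (adjoint (a n) (u n)) ^+ 2 + hnorm (a n (u n.+1)) ^+ 2 -
  rdot (l%:C *: u n - b n (u n)) (a n (u n.+1)).

(** With w = (l - b_(n+1)) u_(n+1) and X = a_n^* u_n the recurrence reads
    a_(n+1) u_(n+2) = w - X, and |w - X|^2 - <w, w - X> = |X|^2 - <w, X>.  The
    remaining terms in l are equal because l is real. *)
Lemma energyS n : energy n.+1 = energy n +
  (hnorm (adjoint (a n.+1) (u n.+1)) ^+ 2 - hnorm (a n (u n.+1)) ^+ 2) +
  rdot (a n (b n.+1 (u n.+1)) - b n (a n (u n.+1))) (u n).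
Proof.
rewrite /energy; set w := l%:C *: u n.+1 - b n.+1 (u n.+1).
have -> : a n.+1 (u n.+2) = w - adjoint (a n) (u n).
  by rewrite /w -recurrence [_ + b _ _ + _]addrAC addrK addrAC subrr add0r.
rewrite hnormBsq rdotBr rdotxx -[rdot w (adjoint _ _)]rdot_adjoint//.
rewrite /w (linear_opB _ _ (la n)) (linear_opZ _ _ (la n)) !rdotBl !rdotZl.
have -> : rdot (b n (u n)) (a n (u n.+1)) = rdot (b n (a n (u n.+1))) (u n).
  by rewrite rdot_adjoint// sb rdotC.
rewrite (rdotC (u n)); ring.
Qed.

(** M n and D n stand for the norms in the numerators of (a) and (b); k is a lower
    bound for a_n / ||a_n||, available only beyond N0. *)
Variables (k : R) (N0 : nat) (M D : nat -> R).
Hypotheses (k0 : 0 < k) (an0 : forall n, 0 < opnorm (a n)).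
Hypothesis (a_below : forall n x, (N0 <= n)%N -> k * opnorm (a n) * hnorm x <= hnorm (a n x)).
Hypothesis (as_below : forall n x, (N0 <= n)%N ->
  k * opnorm (a n) * hnorm x <= hnorm (adjoint (a n) x)).
Hypothesis (b_small : forall n x, (N0 <= n)%N ->
  hnorm (l%:C *: x - b n x) <= hnorm (adjoint (a n) x)).
Hypotheses (M0 : forall n, 0 <= M n) (D0 : forall n, 0 <= D n).
Hypothesis (MP : forall n x, - (M n * hnorm x ^+ 2) <=
  hnorm (adjoint (a n.+1) x) ^+ 2 - hnorm (a n x) ^+ 2).
Hypothesis (DP : forall n x, hnorm (a n (b n.+1 x) - b n (a n x)) <= D n * hnorm x).

Let W n := hnorm (u n) ^+ 2 + hnorm (u n.+1) ^+ 2.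

(** The mixed term is at most |a_n^* u_n| |a_n u_(n+1)| by [b_small], hence at most half
    the sum of the two squares. *)
Lemma energy_bounds n : (N0 <= n)%N ->
  k ^+ 2 / 2 * (opnorm (a n) ^+ 2 * W n) <= energy n <=
  3 / 2 * (opnorm (a n) ^+ 2 * W n).
Proof.
move=> Nn.
have h1 := as_below (u n) Nn; have h2 := a_below (u n.+1) Nn.
have h3 := adjoint_le (u n) (ba n); have h4 := opnormP (u n.+1) (ba n).
have h5 := rdot_le (l%:C *: u n - b n (u n)) (a n (u n.+1)).
have h6 := b_small (u n) Nn.
rewrite /energy /W; move: h5.
have sq (x y : R) : 0 <= x -> x <= y -> x ^+ 2 <= y ^+ 2.
  by move=> x0 xy; rewrite ler_sqr ?nnegrE// (le_trans x0 xy).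
have e1 := sq _ _ (mulr_ge0 (mulr_ge0 (ltW k0) (ltW (an0 n))) (hnorm_ge0 (u n))) h1.
have e2 := sq _ _ (mulr_ge0 (mulr_ge0 (ltW k0) (ltW (an0 n))) (hnorm_ge0 (u n.+1))) h2.
have e3 := sq _ _ (hnorm_ge0 _) h3; have e4 := sq _ _ (hnorm_ge0 _) h4.
move: e1 e2 e3 e4 h6; rewrite !exprMn.
move: (hnorm_ge0 (adjoint (a n) (u n))) (hnorm_ge0 (a n (u n.+1))).
move: (hnorm (adjoint _ _)) (hnorm (a n _)) (hnorm (_ - _)) (rdot _ _).
move: (hnorm _ ^+ 2) (hnorm _ ^+ 2) (opnorm _ ^+ 2) (k ^+ 2).
move=> U V A K p q s r p0 q0 e1 e2 e3 e4 h6 h5.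
have {h5} : `|r| <= p * q by apply: le_trans h5 _; rewrite ler_wpM2r.
rewrite ler_norml => /andP[r1 r2]; have pq := sqr_ge0 (p - q).
apply/andP; split; nra.
Qed.

Lemma energy_decay n : (N0 <= n)%N ->
  (1 - 2 / k ^+ 2 * ((M n + D n) / opnorm (a n) ^+ 2)) * energy n <= energy n.+1.
Proof.
move=> Nn; have /andP[lo _] := energy_bounds Nn.
rewrite energyS mulrBl mul1r -[leRHS]addrA lerD2l.
have h1 := MP n (u n.+1).
have h2 : - (D n * (hnorm (u n.+1) * hnorm (u n))) <=
    rdot (a n (b n.+1 (u n.+1)) - b n (a n (u n.+1))) (u n).
  rewrite lerNl; apply: le_trans (ler_norm _) _; rewrite normrN.
  apply: le_trans (rdot_le _ _) _; rewrite mulrA ler_wpM2r ?hnorm_ge0//.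
have h3 : (M n + D n) * W n <= 2 / k ^+ 2 * ((M n + D n) / opnorm (a n) ^+ 2) * energy n.
  have c0 : 0 <= 2 / k ^+ 2 * ((M n + D n) / opnorm (a n) ^+ 2).
    by rewrite mulr_ge0 ?divr_ge0 ?addr_ge0 ?sqr_ge0.
  apply: le_trans (ler_wpM2l c0 lo); rewrite le_eqVlt; apply/orP; left; apply/eqP.
  by field; rewrite !gt_eqF.
have := hnorm_ge0 (u n); have := hnorm_ge0 (u n.+1).
move: h1 h2 h3; rewrite /W; move: (M0 n) (D0 n) (2 / _ * _ * _).
move: (M n) (D n) (hnorm (u n)) (hnorm (u n.+1)) => m d x y m0 d0 t.
move: (_ - _) (rdot _ _) => p q h1 h2 h3 y0 x0.
have := mulr_ge0 m0 (sqr_ge0 x); have := mulr_ge0 d0 (sqr_ge0 (x - y)).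
have := mulr_ge0 d0 (sqr_ge0 x); have := mulr_ge0 d0 (sqr_ge0 y).
by nra.
Qed.

(** The product of the 1 - t_n is at least 1 - sum t_n. *)
Lemma product_lower_bound (E t : nat -> R) N : (forall n, (N <= n)%N -> 0 <= E n) ->
  (forall n, 0 <= t n) -> (forall n, (N <= n)%N -> (1 - t n) * E n <= E n.+1) ->
  (forall n, \sum_(N <= j < n) t j <= 2^-1) ->
  forall n, (N <= n)%N -> E N / 2 <= E n.
Proof.
move=> E0 t0 step small.
have main i : (1 - \sum_(N <= j < N + i) t j) * E N <= E (N + i)%N.
  elim: i => [|i IH]; first by rewrite addn0 big_geq// subr0 mul1r.
  rewrite addnS big_nat_recr ?leq_addr//=.
  have := step _ (leq_addr i N); apply: le_trans.
  have := small (N + i).+1; rewrite big_nat_recr ?leq_addr//=.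
  have T0 : 0 <= \sum_(N <= j < N + i) t j by exact: sumr_ge0.
  move: (\sum_(_ <= _ < _) _) (t (N + i)%N) (t0 (N + i)%N) T0 IH (E0 _ (leqnn N)).
  move: (E (N + i)%N) (E N) => e eN T s s0 T0 IH eN0 sm.
  have : (1 - s) * ((1 - T) * eN) <= (1 - s) * e by rewrite ler_wpM2l//; lra.
  have := mulr_ge0 (mulr_ge0 s0 T0) eN0; nra.
move=> n Nn; have := main (n - N)%N; rewrite subnKC//; apply: le_trans.
have := small n; have := E0 _ (leqnn N).
by move: (\sum_(_ <= _ < _) _) (E N) => *; nra.
Qed.

Variable (K : R).
Hypothesis (sumMD : forall n, \sum_(1 <= j < n) (M j + D j) / opnorm (a j) ^+ 2 <= K).
Hypothesis (sum_inv : forall N (L : R), exists n, L <= \sum_(N <= j < n) (opnorm (a j) ^+ 2)^-1).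
Hypothesis (as_inj : forall n x, adjoint (a n) x = 0 -> x = 0).
Variable (B : R).
Hypothesis (u_l2 : forall n, \sum_(0 <= j < n) hnorm (u j) ^+ 2 <= B).

(** If the energy were positive at an index N beyond which the decay rates sum up to
    at most 1/2, it would stay above half its value, and |u_n|^2 + |u_(n+1)|^2 would
    dominate a multiple of 1 / ||a_n||^2. *)
Lemma square_summable_solution_vanishes n : u n = 0.
Proof.
have MD0 j : 0 <= (M j + D j) / opnorm (a j) ^+ 2 by rewrite divr_ge0 ?addr_ge0 ?sqr_ge0.
have c0 : 0 < 2 / k ^+ 2 by rewrite divr_gt0 ?exprn_gt0.
have e0 : 0 < 2^-1 / (2 / k ^+ 2) by rewrite divr_gt0 ?invr_gt0.
have [N1 N11 hN1] := bounded_sums_tail MD0 sumMD e0.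
pose N := maxn N0 N1; pose t j := 2 / k ^+ 2 * ((M j + D j) / opnorm (a j) ^+ 2).
have small m : \sum_(N <= j < m) t j <= 2^-1.
  rewrite /t -mulr_sumr mulrC -ler_pdivlMr//; apply: le_trans (hN1 m).
  have [mN|/ltnW Nm] := leqP m N; first by rewrite big_geq// sumr_ge0.
  by rewrite [leRHS](@big_cat_nat _ _ _ N)//= ?leq_maxr// lerDr sumr_ge0.
have N0N m : (N <= m)%N -> (N0 <= m)%N by apply: leq_trans; exact: leq_maxl.
have W0 m : 0 <= W m by rewrite /W addr_ge0 ?sqr_ge0.
have E0 m : (N <= m)%N -> 0 <= energy m.
  move=> /N0N /energy_bounds/andP[lo _]; apply: le_trans lo.
  by apply: mulr_ge0; [rewrite divr_ge0 ?sqr_ge0|exact: mulr_ge0 (sqr_ge0 _) (W0 m)].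
have half := @product_lower_bound energy t N E0 (fun j => mulr_ge0 (ltW c0) (MD0 j))
  (fun m Nm => energy_decay (N0N _ Nm)) small.
have EN : energy N = 0.
  apply/eqP; rewrite eq_le E0// andbT leNgt; apply/negP => EN.
  have B2 m : \sum_(N <= j < m) W j <= 2 * B.
    have [mN|/ltnW Nm] := leqP m N.
      by rewrite big_geq// mulr_ge0//; have := u_l2 0%N; rewrite big_geq.
    have : \sum_(0 <= j < m) W j <= 2 * B.
      rewrite /W big_split /= mulrDl mul1r lerD//.
      by apply: le_trans (u_l2 m.+1); rewrite big_nat_recl//= lerDr sqr_ge0.
    by apply: le_trans; rewrite [leRHS](@big_cat_nat _ _ _ N)//= lerDr sumr_ge0.
  have [m hm] := sum_inv N ((2 * B + 1) / (energy N / 3)).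
  have E3 : 0 < energy N / 3 by rewrite divr_gt0.
  have : \sum_(N <= j < m) (energy N / 3) * (opnorm (a j) ^+ 2)^-1 <= \sum_(N <= j < m) W j.
    apply: ler_sum_nat => j /andP[Nj _].
    have /andP[_ up] := energy_bounds (N0N _ Nj).
    rewrite ler_pdivrMr ?exprn_gt0// mulrC [W j * _]mulrC; have h := le_trans (half _ Nj) up.
    by move: h; lra.
  rewrite -mulr_sumr => h; have := le_trans h (B2 m).
  move: hm; rewrite ler_pdivrMr// => hm; lra.
have WN : W N = 0.
  have /andP[lo _] := energy_bounds (N0N _ (leqnn N)).
  apply/eqP; rewrite eq_le W0 andbT; move: lo; rewrite EN mulrA pmulr_rle0//.
  by rewrite mulr_gt0 ?divr_gt0 ?exprn_gt0.
have [uN uN1] : u N = 0 /\ u N.+1 = 0.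
  move/eqP: WN; rewrite /W paddr_eq0 ?sqr_ge0// !sqrf_eq0 !hnorm_eq0.
  by move=> /andP[/eqP-> /eqP->].
have down j : u (N - j)%N = 0 /\ u (N - j).+1 = 0.
  elim: j => [|j [IH1 IH2]]; first by rewrite subn0.
  have [Nj|jN] := leqP N j.
    have e : (N - j = 0)%N by apply/eqP; rewrite subn_eq0.
    by have e' : (N - j.+1 = 0)%N; [apply/eqP; rewrite subn_eq0 leqW|rewrite e' -e].
  have e : (N - j = (N - j.+1).+1)%N by rewrite subnS prednK// subn_gt0.
  rewrite e in IH1 IH2; split => //; apply: (@as_inj (N - j.+1)%N).
  have := recurrence (N - j.+1); rewrite IH1 IH2.
  by rewrite (linear_op0 (lb _)) (linear_op0 (la _)) scaler0 !addr0.
have up j : u (N + j)%N = 0 /\ u (N + j).+1 = 0.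
  elim: j => [|j [IH1 IH2]]; first by rewrite addn0.
  rewrite addnS; split => //.
  have := recurrence (N + j); rewrite IH1 IH2.
  rewrite (linear_op0 (lb _)) (linear_op0 (las _)) scaler0 !add0r => e.
  have := opnormP (u (N + j).+2) (ba (N + j).+1).
  have le : (N0 <= (N + j).+1)%N by apply: N0N; rewrite leqW// leq_addr.
  have := a_below (u (N + j).+2) le; rewrite e hnorm0 => h _.
  apply/eqP; rewrite -hnorm_eq0 eq_le hnorm_ge0 andbT.
  by move: h; rewrite pmulr_rle0// mulr_gt0.
have [nN|/ltnW Nn] := leqP n N.
  by have [] := down (N - n)%N; rewrite subKn.
by have [] := up (n - N)%N; rewrite subnKC.
Qed.

End Energy.

(** * Operator estimates behind the energy bounds *)

Section OperatorEstimates.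
Variables (R : realType) (H : hilbertType R).
Implicit Types (X Y b : H -> H).

Lemma inverse_norm_bound X Y : bounded_operator X -> is_bounded_inverse X Y ->
  (exists x : H, x != 0) -> 1 <= opnorm X * opnorm Y.
Proof.
move=> bX [bY XK YK] [x x0]; have x1 : 0 < hnorm x by rewrite hnorm_gt0.
rewrite -(ler_pM2r x1) mul1r mulrAC -{1}(XK x) mulrC.
apply: le_trans (opnormP _ bY) _; rewrite ler_wpM2l ?opnorm_ge0//.
exact: opnormP.
Qed.

(** The square of |x| is <X^* x, Y x>, and |Y x| <= |x| / c. *)
Lemma adjoint_below X Y (c : R) : bounded_operator X -> is_bounded_inverse X Y -> 0 < c ->
  (forall x, c * hnorm x <= hnorm (X x)) ->
  forall x, c * hnorm x <= hnorm (adjoint X x).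
Proof.
move=> bX [bY XK YK] c0 h x.
have [->|x0] := eqVneq x 0; first by rewrite hnorm0 mulr0 hnorm_ge0.
have x1 : 0 < hnorm x by rewrite hnorm_gt0.
rewrite -(ler_pM2r x1) -mulrA -expr2 -rdotxx -{2}(YK x) [rdot x _]rdotC rdot_adjoint// rdotC.
apply: le_trans (_ : c * (hnorm (adjoint X x) * hnorm (Y x)) <= _).
  by rewrite ler_wpM2l ?(ltW c0)// ler_rdot.
rewrite mulrCA ler_wpM2l ?hnorm_ge0//.
by apply: le_trans (h _) _; rewrite YK.
Qed.

(** With y = (l - b) x, |y|^2 = <x, (l - b) y> = <X^* x, Y (l - b) y>. *)
Lemma diagonal_small X Y b (l : R) : bounded_operator X -> is_bounded_inverse X Y ->
  bounded_operator b -> adjoint b = b ->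
  `|l| * opnorm Y + opnorm (Y \o b) <= 1 ->
  forall x, hnorm (l%:C *: x - b x) <= hnorm (adjoint X x).
Proof.
move=> bX [bY XK YK] bb sb small x; have [lY _] := bY.
set y := l%:C *: x - b x.
have [->|y0] := eqVneq y 0; first by rewrite hnorm0 hnorm_ge0.
have y1 : 0 < hnorm y by rewrite hnorm_gt0.
rewrite -(ler_pM2r y1) -expr2 -rdotxx {1}/y rdotBl rdotZl rdot_adjoint// sb.
rewrite -rdotZr -rdotBr -[l%:C *: y - b y]YK [rdot x _]rdotC rdot_adjoint// rdotC.
apply: le_trans (ler_rdot _ _) _; rewrite ler_wpM2l ?hnorm_ge0//.
rewrite (linear_opB _ _ lY) (linear_opZ _ _ lY).
apply: le_trans (ler_hnormB _ _) _; rewrite hnormZr.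
have h1 := opnormP y bY; have h2 := opnormP y (bounded_comp bY bb).
have := ler_wpM2l (normr_ge0 l) h1; rewrite mulrA /= in h2 * => h3.
apply: le_trans (lerD h3 h2) _; rewrite -mulrDl -[leRHS]mul1r.
by rewrite ler_wpM2r ?hnorm_ge0.
Qed.

(** C is bounded below by 1 / K, and X / s differs from it by at most half of that. *)
Lemma scaled_limit_below X C Cinv (s K : R) : bounded_operator X -> bounded_operator C ->
  cancel C Cinv -> 0 < s -> 0 < K -> (forall x, hnorm (Cinv x) <= K * hnorm x) ->
  opnorm (fun x => s^-1%:C *: X x - C x) <= (2 * K)^-1 ->
  forall x, (2 * K)^-1 * s * hnorm x <= hnorm (X x).
Proof.
move=> bX bC CK s0 K0 hK small x; have [lX _] := bX; have [lC [M hM]] := bC.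
have bd : bounded_operator (fun x => s^-1%:C *: X x - C x).
  apply: (bounded_opP (K := s^-1 * opnorm X + M)) => [k u v|u].
    by rewrite lX lC scalerBr scalerDr !scalerA [k * _]mulrC opprD addrACA.
  apply: le_trans (ler_hnormB _ _) _; rewrite mulrDl lerD//.
  rewrite hnormZr ger0_norm ?invr_ge0 ?(ltW s0)// -mulrA.
  by rewrite ler_wpM2l ?invr_ge0 ?(ltW s0)// opnormP.
have h1 := opnormP x bd.
have h2 : hnorm x <= K * hnorm (C x) by rewrite -{1}(CK x).
have h3 : hnorm (C x) <= s^-1 * hnorm (X x) + (2 * K)^-1 * hnorm x.
  have := ler_hnormB (s^-1%:C *: X x) (s^-1%:C *: X x - C x).
  rewrite subKr => /le_trans; apply; rewrite hnormZr ger0_norm ?invr_ge0 ?(ltW s0)//.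
  by rewrite lerD2l (le_trans h1)// ler_wpM2r ?hnorm_ge0.
have h4 : (2 * K)^-1 * hnorm x <= s^-1 * hnorm (X x).
  have : K^-1 * hnorm x <= hnorm (C x) by rewrite mulrC ler_pdivrMr// mulrC.
  by rewrite invfM; move: h3; rewrite invfM; lra.
by move: h4; rewrite [s^-1 * _]mulrC ler_pdivlMr// mulrAC.
Qed.

(** 1 / al_n^2 <= 1 / al_n as soon as al_n = 0 or al_n >= 1. *)
Lemma harmonic_unbounded (al : nat -> R) :
  (forall n, 0 <= al n) -> (exists N, forall n, (N <= n)%N -> al n = 0 \/ 1 <= al n) ->
  (forall N (K : R), exists n, K <= \sum_(N <= j < n) (al j ^+ 2)^-1) ->
  forall N (K : R), exists n, K <= \sum_(N <= j < n) (al j)^-1.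
Proof.
move=> a0 [N1 hN1] h N K; have [n hn] := h (maxn N N1) `|K|.
exists n; apply: le_trans (ler_norm K) _; apply: le_trans hn _.
apply: (@le_trans _ _ (\sum_(maxn N N1 <= j < n) (al j)^-1)).
  apply: ler_sum_nat => j /andP[Nj _].
  have [->|j1] := hN1 j (leq_trans (leq_maxr _ _) Nj); first by rewrite expr0n.
  by rewrite lef_pV2 ?posrE ?exprn_gt0 ?(lt_le_trans ltr01 j1)// expr2 ler_peMr.
have pos m m' : 0 <= \sum_(m <= j < m') (al j)^-1 by apply: sumr_ge0 => j _; rewrite invr_ge0.
have [mN|/ltnW Nm] := leqP n (maxn N N1); first by rewrite big_geq.
by rewrite [leRHS](@big_cat_nat _ _ _ (maxn N N1))//= ?leq_maxl// lerDr.
Qed.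

Section GramDifference.
Variables X Y : H -> H.
Hypotheses (bX : bounded_operator X) (bY : bounded_operator Y).

Let Z := (X \o adjoint X) \- (adjoint Y \o Y).

Lemma gram_difference_bounded : bounded_operator Z.
Proof. by apply: bounded_sub; apply: bounded_comp => //; exact: adjoint_bounded. Qed.

Lemma gram_difference_symmetric : symmetric_operator Z.
Proof.
move=> u v; rewrite linearBl /= linearBr /= (adjointP (adjoint X u) v bX).
by rewrite (adjointPr u (adjoint X v) bX) -(adjointPr (Y u) v bY) -(adjointP u (Y v) bY).
Qed.

Lemma gram_difference_form x : - (opnorm (negative_part Z) * hnorm x ^+ 2) <=
  hnorm (adjoint X x) ^+ 2 - hnorm (Y x) ^+ 2.
Proof.
have -> : hnorm (adjoint X x) ^+ 2 - hnorm (Y x) ^+ 2 = rdot (Z x) x.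
  rewrite rdotBl /= rdot_adjoint// rdotxx [rdot (adjoint _ _) _]rdotC.
  by rewrite -rdot_adjoint// rdotxx.
exact: negative_part_form_ge gram_difference_bounded gram_difference_symmetric x.
Qed.

Lemma gram_negative_part_ge0 : 0 <= opnorm (negative_part Z).
Proof.
apply: opnorm_ge0.
by have [] := negative_part_calculus gram_difference_bounded gram_difference_symmetric.
Qed.

End GramDifference.

End OperatorEstimates.

(** * Jacobi matrices under the hypotheses of the theorem *)

(** On the zero space all norms vanish, and so do their inverses. *)
Lemma nontrivial_of_unbounded (R : realType) (H : hilbertType R) (a : nat -> H -> H) :
  (forall n, bounded_operator (a n)) ->
  (forall N (K : R), exists n, K <= \sum_(N <= j < n) (opnorm (a j) ^+ 2)^-1) ->
  exists x : H, x != 0.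
Proof.
move=> ba h; apply: contrapT => /forallNP x0.
have [n] := h 0%N 1; rewrite big1 ?ler10// => j _.
have -> : opnorm (a j) = 0.
  apply/eqP; rewrite eq_le opnorm_ge0// andbT; apply: opnorm_le => // x.
  by have /negP/negPn/eqP -> := x0 (a j x); rewrite hnorm0 mul0r.
by rewrite expr0n invr0.
Qed.

Lemma eventually_lt (R : realType) (f : nat -> R) (e : R) : 0 < e ->
  f n @[n --> \oo] --> (0 : R) -> exists N, forall n, (N <= n)%N -> f n < e.
Proof.
move=> e0 /cvgrPdist_lt/(_ _ e0)[N _ hN]; exists N => n Nn.
by have := hN n Nn; rewrite /= sub0r normrN; apply: le_lt_trans; exact: ler_norm.
Qed.

Section Main.
Variables (R : realType) (H : hilbertType R) (a ainv b : nat -> H -> H).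
Hypotheses (a_bounded : forall n, bounded_operator (a n))
  (a_inv : forall n, is_bounded_inverse (a n) (ainv n))
  (b_bounded : forall n, bounded_operator (b n))
  (b_selfadjoint : forall n, adjoint (b n) = b n)
  (lim_ainv : opnorm (ainv n) @[n --> \oo] --> (0 : R))
  (lim_ainvb : opnorm (ainv n \o b n) @[n --> \oo] --> (0 : R))
  (sum_a : (\sum_(1 <= n <oo)
     (opnorm (negative_part
        ((a n.+1 \o adjoint (a n.+1)) \- (adjoint (a n) \o a n))) /
      opnorm (a n) ^+ 2)%:E < +oo)%E)
  (sum_b : (\sum_(1 <= n <oo)
     (opnorm ((a n \o b n.+1) \- (b n \o a n)) / opnorm (a n) ^+ 2)%:E
     < +oo)%E)
  (sum_c : (\sum_(0 <= n <oo) (1 / opnorm (a n) ^+ 2)%:E = +oo)%E).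

Lemma unbounded_inverse_squares N (K : R) :
  exists n, K <= \sum_(N <= j < n) (opnorm (a j) ^+ 2)^-1.
Proof.
have pos n : 0 <= 1 / opnorm (a n) ^+ 2 by rewrite divr_ge0 ?sqr_ge0.
have [n hn] := infinite_eseries_unbounded pos sum_c N K; exists n.
by under eq_bigr do rewrite -div1r.
Qed.

Lemma carleman_condition N (K : R) :
  exists n, K <= \sum_(N <= j < n) (opnorm (a j))^-1.
Proof.
apply: (harmonic_unbounded (fun n => opnorm_ge0 (a_bounded n)) _ unbounded_inverse_squares).
have [N1 hN1] := eventually_lt ltr01 lim_ainv; exists N1 => n /hN1 lt; right.
have x0 := nontrivial_of_unbounded a_bounded unbounded_inverse_squares.
apply: le_trans (inverse_norm_bound (a_bounded n) (a_inv n) x0) _.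
by rewrite ler_piMr ?opnorm_ge0// ltW.
Qed.

Hypothesis a_limit : exists C Cinv : H -> H,
      [/\ bounded_operator C, is_bounded_inverse C Cinv &
          opnorm (fun x => (opnorm (a n))^-1%:C *: a n x - C x) @[n --> \oo]
            --> (0 : R)].

Lemma no_square_summable_solution (l : R) (u : l2 H) :
  (forall n, formal_jacobi a b (val u) n.+1 = l%:C *: val u n.+1) -> u = 0.
Proof.
move=> rec; have x0 := nontrivial_of_unbounded a_bounded unbounded_inverse_squares.
have [C [Cinv [bC [[lCi [M hM]] CK _] lim_C]]] := a_limit.
have an0 n : 0 < opnorm (a n).
  have := inverse_norm_bound (a_bounded n) (a_inv n) x0.
  rewrite lt_neqAle opnorm_ge0// andbT eq_sym => h; apply: contraTneq h => ->.
  by rewrite mul0r ler10.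
pose K := `|M| + 1; have K0 : 0 < K by rewrite ltr_wpDl.
have hK x : hnorm (Cinv x) <= K * hnorm x.
  apply: le_trans (hM x) _; rewrite ler_wpM2r ?hnorm_ge0//.
  by rewrite (le_trans (ler_norm M))// lerDl.
have k0 : 0 < (2 * K)^-1 by rewrite invr_gt0 mulr_gt0.
have [N1 hN1] := eventually_lt k0 lim_C.
have d0 : 0 < (2 * (`|l| + 1))^-1 by rewrite invr_gt0 mulr_gt0// ltr_wpDl.
have [N2 hN2] := eventually_lt d0 lim_ainv.
have half0 : 0 < 2^-1 :> R by rewrite invr_gt0.
have [N3 hN3] := eventually_lt half0 lim_ainvb.
pose N0 := maxn N1 (maxn N2 N3).
have N01 n : (N0 <= n)%N -> [/\ (N1 <= n)%N, (N2 <= n)%N & (N3 <= n)%N].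
  by rewrite !geq_max => /and3P[].
have below n x : (N0 <= n)%N -> (2 * K)^-1 * opnorm (a n) * hnorm x <= hnorm (a n x).
  move=> /N01[n1 _ _].
  exact: (scaled_limit_below (a_bounded n) bC CK (an0 n) K0 hK (ltW (hN1 n n1)) x).
have as_below n x : (N0 <= n)%N ->
    (2 * K)^-1 * opnorm (a n) * hnorm x <= hnorm (adjoint (a n) x).
  move=> Nn; apply: (adjoint_below (a_bounded n) (a_inv n)); first by rewrite mulr_gt0.
  by move=> y; exact: below.
have b_small n x : (N0 <= n)%N -> hnorm (l%:C *: x - b n x) <= hnorm (adjoint (a n) x).
  move=> /N01[_ n2 n3]; apply: (diagonal_small (a_bounded n) (a_inv n)) => //.
  have := hN2 _ n2; have := hN3 _ n3; move=> h3 h2.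
  have l1 : 0 < `|l| + 1 by rewrite ltr_wpDl.
  have : `|l| * opnorm (ainv n) <= 2^-1.
    apply: le_trans (ler_wpM2l (normr_ge0 l) (ltW h2)) _.
    rewrite ler_pdivrMr ?mulr_gt0// mulrA mulVf ?mul1r ?lerDl//.
  by move: h3; lra.
pose MM n := opnorm (negative_part ((a n.+1 \o adjoint (a n.+1)) \- (adjoint (a n) \o a n))).
pose DD n := opnorm ((a n \o b n.+1) \- (b n \o a n)).
have MM0 n : 0 <= MM n by exact: gram_negative_part_ge0.
have bD n : bounded_operator ((a n \o b n.+1) \- (b n \o a n)).
  by apply: bounded_sub; exact: bounded_comp.
have DD0 n : 0 <= DD n by exact: opnorm_ge0.
have [K1 hK1] := finite_eseries_bounded (fun n => divr_ge0 (MM0 n) (sqr_ge0 (opnorm (a n)))) sum_a.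
have [K2 hK2] := finite_eseries_bounded (fun n => divr_ge0 (DD0 n) (sqr_ge0 (opnorm (a n)))) sum_b.
have sumMD n : \sum_(1 <= j < n) (MM j + DD j) / opnorm (a j) ^+ 2 <= K1 + K2.
  by under eq_bigr do rewrite mulrDl; rewrite big_split lerD.
have as_inj n x : adjoint (a n) x = 0 -> x = 0.
  move=> ax; have [bY XK YK] := a_inv n; apply: inner_inj => y.
  by rewrite -(YK y) adjointP// ax !linear0r.
apply/val_inj/funext => n.
exact: (square_summable_solution_vanishes a_bounded b_bounded b_selfadjoint rec k0 an0 below
  as_below b_small MM0 DD0 (fun n x => gram_difference_form (a_bounded n.+1) (a_bounded n) x)
  (fun n x => opnormP x (bD n)) sumMD unbounded_inverse_squares as_inj (hnorm_l2_series_le u)).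
Qed.

Lemma block_jacobi_no_eigenvalue : point_spectrum (block_jacobi a b) = set0.
Proof.
have aT := block_jacobi_adjoint a_bounded b_bounded b_selfadjoint carleman_condition.
apply/seteqP; split => // z [u u0 Tu].
have zr := selfadjoint_eigenvalue_real aT u0 Tu.
have zE : z = (complex.Re z)%:C by case: (z) zr => p q /= ->.
move/eqP: u0; apply; apply: (@no_square_summable_solution (complex.Re z)) => n.
move: Tu; rewrite (block_jacobiE a_bounded b_bounded b_selfadjoint carleman_condition) {1}zE.
move=> E; have {}E : val ((complex.Re z)%:C *: u) = formal_jacobi a b (val u) := E.
by rewrite -E.
Qed.

Lemma block_jacobi_spectrum : spectrum (block_jacobi a b) = [set t%:C | t in [set: R]].
Proof.
have aT := block_jacobi_adjoint a_bounded b_bounded b_selfadjoint carleman_condition.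
apply/seteqP; split => [z /(selfadjoint_spectrum_real aT) zr|_ [t _ <-] [B [bB hB]]].
  by exists (complex.Re z) => //; case: (z) zr => p q /= ->.
have [x x0] := nontrivial_of_unbounded a_bounded unbounded_inverse_squares.
have [v vE] : exists v : l2 H, val v = fun k => if k == 0%N then x else 0.
  by apply: (@fin_l2 _ _ _ 1) => -[].
have : block_jacobi a b (B v, v + t%:C *: B v) by apply/hB; rewrite addrK.
rewrite (block_jacobiE a_bounded b_bounded b_selfadjoint carleman_condition).
move=> TE; have {}TE : val (v + t%:C *: B v) = formal_jacobi a b (val (B v)) := TE.
have u0 : B v = 0.
  apply: (@no_square_summable_solution t) => n.
  by rewrite -TE -[LHS]/(val v n.+1 + t%:C *: val (B v) n.+1) vE add0r.
have := congr1 (fun w => w 0%N) TE; rewrite u0 scaler0 addr0 vE /=.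
have [la _] := a_bounded 0%N; have [lb _] := b_bounded 0%N.
rewrite (linear_op0 la) (linear_op0 lb) addr0 => xx.
by move: x0; rewrite xx eqxx.
Qed.

End Main.

Theorem theorem1 (R : realType) (H : hilbertType R)
  (a ainv b : nat -> H -> H)
  (a_bounded : forall n, bounded_operator (a n))
  (a_inv : forall n, is_bounded_inverse (a n) (ainv n))
  (b_bounded : forall n, bounded_operator (b n))
  (b_selfadjoint : forall n, adjoint (b n) = b n)
  (lim_ainv : opnorm (ainv n) @[n --> \oo] --> (0 : R))
  (lim_ainvb : opnorm (ainv n \o b n) @[n --> \oo] --> (0 : R))
  (sum_a : (\sum_(1 <= n <oo)
     (opnorm (negative_part
        ((a n.+1 \o adjoint (a n.+1)) \- (adjoint (a n) \o a n))) /
      opnorm (a n) ^+ 2)%:E < +oo)%E)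
  (sum_b : (\sum_(1 <= n <oo)
     (opnorm ((a n \o b n.+1) \- (b n \o a n)) / opnorm (a n) ^+ 2)%:E
     < +oo)%E)
  (sum_c : (\sum_(0 <= n <oo) (1 / opnorm (a n) ^+ 2)%:E = +oo)%E) :
  selfadjoint (block_jacobi a b) /\
  ((exists C Cinv : H -> H,
      [/\ bounded_operator C, is_bounded_inverse C Cinv &
          opnorm (fun x => (opnorm (a n))^-1%:C *: a n x - C x) @[n --> \oo]
            --> (0 : R)]) ->
   spectrum (block_jacobi a b) = [set t%:C | t in [set: R]] /\
   point_spectrum (block_jacobi a b) = set0).
Proof.
have carl := carleman_condition a_bounded a_inv lim_ainv sum_c.
split; first exact: block_jacobi_selfadjoint.
move=> a_limit; split.
  exact: (block_jacobi_spectrum a_bounded a_inv b_bounded b_selfadjoint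
    lim_ainv lim_ainvb sum_a sum_b sum_c a_limit).
exact: (block_jacobi_no_eigenvalue a_bounded a_inv b_bounded b_selfadjoint
  lim_ainv lim_ainvb sum_a sum_b sum_c a_limit).
Qed.
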